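(* Let $\alpha\in\mathcal A^t$ (resp. $\widehat{\mathcal A}^t$) for some $t\in[0,T]$ and let $\tau$ be an $\mathbf F^t$-stopping time taking values in a countable subset $\{t_n\}_{n\in\mathbb N}$ of $\mathbb Q_{t,T}$. Given $N\in\mathbb N$, let $\{A^n_i\}_{i=1}^{\ell_n}\subset\mathcal F^t_{t_n}$ be disjoint subsets of $\{\tau=t_n\}$ for $n=1,\dots,N$, and set $A_0=\Omega^t\setminus\big(\bigcup_{n=1}^N\bigcup_{i=1}^{\ell_n}A^n_i\big)$. Then for any $\{\alpha^n_i\}_{i=1}^{\ell_n}\subset\mathcal A^{t_n}$ (resp. $\widehat{\mathcal A}^{t_n}$), $n=1,\dots,N$, the map defined for all $v\in\mathbb V$ by $$\widehat\alpha(r,\omega,v)=\begin{cases}\alpha^n_i\big(r,\Pi_{t,t_n}(\omega),v\big),&\text{if }(r,\omega)\in[\![\tau,T]\!]_{A^n_i}=[t_n,T]\times A^n_i\text{ for some }n=1,\dots,N,\ i=1,\dots,\ell_n,\\ \alpha(r,\omega,v),&\text{if }(r,\omega)\in[\![t,\tau[\![\,\cup\,[\![\tau,T]\!]_{A_0},\end{cases}$$ is an $\mathcal A^t$-strategy (resp. $\widehat{\mathcal A}^t$-strategy) such that, given $\nu\in\mathcal V^t$, it holds for $P^t_0$-a.s. $\omega\in\Omega^t$ that for any $r\in[\tau(\omega),T]$ $$\big(\widehat\alpha\langle\nu\rangle\big)^{\tau,\omega}_r=\begin{cases}\big(\alpha^n_i\langle\nu^{t_n,\omega}\rangle\big)_r,&\text{if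 }\omega\in A^n_i\text{ for some }n=1,\dots,N,\ i=1,\dots,\ell_n,\\ \big(\alpha\langle\nu\rangle\big)^{\tau,\omega}_r,&\text{if }\omega\in A_0.\end{cases}$$ In the same manner one can paste $\{\beta^n_i\}_{i=1}^{\ell_n}\subset\mathfrak B^{t_n}$ (resp. $\widehat{\mathfrak B}^{t_n}$), $n=1,\dots,N$, to a $\beta\in\mathfrak B^t$ (resp. $\widehat{\mathfrak B}^t$) with respect to $\{A^n_i\}_{i=1}^{\ell_n}$, $n=1,\dots,N$.
   Context: **Path spaces.** Fix $d\in\mathbb{N}$, $T\in(0,\infty)$. For $t\in[0,T]$ let $\Omega^t=\{\omega\in C([t,T];\mathbb{R}^d):\omega(t)=0\}$ with norm $\|\omega\|_t=\sup_{s\in[t,T]}|\omega(s)|$, $B^t$ the canonical process, $P^t_0$ the Wiener measure on $\mathcal B(\Omega^t)$, $E_t$ its expectation, $\mathbf F^t=\{\mathcal F^t_s\}_{s\in[t,T]}$, $\mathcal F^t_s=\sigma(B^t_r;r\in[t,s])$, $\mathscr P(\mathbf F^t)$ the progressive $\sigma$-field. $\mathbb Q_{t,T}=([t,T)\cap\mathbb Q)\cup\{T\}$. For $t\le s\le T$, $\Pi_{t,s}:\Omega^t\to\Omega^s$ is $(\Pi_{t,s}(\omega))(r)=\omega(r)-\omega(s)$, $r\in[s,T]$. For an $\mathbf F^t$-stopping time $\tau$: $[\![t,\tau[\![=\{(r,\omega)\in[t,T]\times\Omega^t:r<\tau(\omega)\}$, $[\![\tau,T]\!]_A=\{(r,\omega)\in[t,T]\times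 A:r\ge\tau(\omega)\}$ for $A\in\mathcal F^t_\tau$. **Shifts.** For $\omega\in\Omega^t$, $\widetilde\omega\in\Omega^s$, $s\in[t,T]$: $(\omega\otimes_s\widetilde\omega)(r)=\omega(r)\mathbf 1_{\{r\in[t,s)\}}+(\omega(s)+\widetilde\omega(r))\mathbf 1_{\{r\in[s,T]\}}$. For a process $X$ on $\Omega^t$, $X^{s,\omega}_r(\widetilde\omega)=X_r(\omega\otimes_s\widetilde\omega)$, $r\in[s,T]$, and $X^{\tau,\omega}=X^{\tau(\omega),\omega}$. **Controls.** $(\mathbb U,\rho_{\mathbb U})$, $(\mathbb V,\rho_{\mathbb V})$ are separable metric spaces with fixed $u_0,v_0$, $[u]_{\mathbb U}=\rho_{\mathbb U}(u,u_0)$, $[v]_{\mathbb V}=\rho_{\mathbb V}(v,v_0)$; $\mathbb U_0\subset\mathbb U$, $\mathbb V_0\subset\mathbb V$ non-empty. $\mathcal U^t$: $\mathbb U$-valued $\mathbf F^t$-progressively measurable $\mu$ with $\mu_r\in\mathbb U_0$ $dr\times dP^t_0$-a.s. and $E_t\int_t^T[\mu_r]_{\mathbb U}^2dr<\infty$; $\mathcal V^t$ likewise with $\mathbb V,\mathbb V_0$. (For $\nu\in\mathcal V^t$ and $s\in[t,T]$, $\nu^{s,\omega}\in\mathcal V^s$ for $P^t_0$-a.s. $\omega$.) **Strategies.** $\mathcal A^t$ is the set of $\mathscr P(\mathbf F^t)\otimes\mathcal B(\mathbb V)/\mathcal B(\mathbb U)$-measurable $\alpha:[t,T]\times\Omega^t\times\mathbb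 V\to\mathbb U$ such that (i) $\alpha(r,\mathbb V_0)\subset\mathbb U_0$, $dr\times dP^t_0$-a.s.; (ii) for some $\kappa>0$ and some non-negative measurable process $\Psi$ on $(\Omega^t,\mathcal F^t_T)$ with $E_t\int_t^T\Psi_r^2dr<\infty$, it holds $dr\times dP^t_0$-a.s. that $[\alpha(r,\omega,v)]_{\mathbb U}\le\Psi_r(\omega)+\kappa[v]_{\mathbb V}$ for all $v\in\mathbb V$. $\widehat{\mathcal A}^t$ is the set of $\alpha\in\mathcal A^t$ such that for any $\varepsilon>0$ there are $\delta>0$ and a closed $F\subset\Omega^t$ with $P^t_0(F)>1-\varepsilon$ and $\sup_{r\in[t,T]}\sup_{v\in\mathbb V}\rho_{\mathbb U}(\alpha(r,\omega,v),\alpha(r,\omega',v))<\varepsilon$ for all $\omega,\omega'\in F$ with $\|\omega-\omega'\|_t<\delta$. $\mathfrak B^t$ and $\widehat{\mathfrak B}^t$ (maps $\beta:[t,T]\times\Omega^t\times\mathbb U\to\mathbb V$) are defined symmetrically. For $\alpha\in\mathcal A^t$ and $\nu\in\mathcal V^t$, $(\alpha\langle\nu\rangle)_r(\omega)=\alpha(r,\omega,\nu_r(\omega))$; similarly $(\beta\langle\mu\rangle)_r(\omega)=\beta(r,\omega,\mu_r(\omega))$. *)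

(* Defs.v *)
From HB Require Import structures.
From mathcomp Require Import all_boot all_order all_algebra.
From mathcomp Require Import all_classical all_reals all_analysis.
From mathcomp Require Import ring.

Set Implicit Arguments.
Unset Strict Implicit.
Unset Printing Implicit Defensive.

Import Order.TTheory GRing.Theory Num.Theory.
Import numFieldNormedType.Exports.

Local Open Scope ring_scope.
Local Open Scope classical_set_scope.

(* The library norm on 'rV[R]_d is the sup norm; the Euclidean one is needed
   for the uniform norm of paths. *)
Definition enorm (R : realType) (d : nat) (x : 'rV[R]_d) : R :=
  Num.sqrt (\sum_(j < d) x 0 j ^+ 2).

Section enorm_lemmas.
Context {R : realType} {d : nat}.
Implicit Types x y : 'rV[R]_d.

Lemma enorm_ge0 x : 0 <= enorm x.
Proof. exact: sqrtr_ge0. Qed.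

Lemma sqr_enorm x : enorm x ^+ 2 = \sum_(j < d) x 0 j ^+ 2.
Proof. by rewrite sqr_sqrtr// sumr_ge0// => j _; exact: sqr_ge0. Qed.

Lemma enorm_eq0 x : enorm x = 0 -> x = 0.
Proof.
move=> /(congr1 (fun z => z ^+ 2)); rewrite sqr_enorm expr0n/= => /eqP.
rewrite psumr_eq0; last by move=> j _; exact: sqr_ge0.
move=> /allP x0; apply/rowP => j; rewrite mxE.
by have := x0 j (mem_index_enum j); rewrite /= sqrf_eq0 => /eqP.
Qed.

Lemma enorm0 : enorm (0 : 'rV[R]_d) = 0.
Proof.
by rewrite /enorm big1 ?sqrtr0// => j _; rewrite mxE expr0n.
Qed.

Lemma enormN x : enorm (- x) = enorm x.
Proof. by congr Num.sqrt; apply: eq_bigr => j _; rewrite mxE sqrrN. Qed.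

Lemma enorm_cauchy_schwarz x y :
  \sum_(j < d) x 0 j * y 0 j <= enorm x * enorm y.
Proof.
have [->|x0] := eqVneq x 0.
  by rewrite enorm0 mul0r big1// => j _; rewrite mxE mul0r.
have [->|y0] := eqVneq y 0.
  by rewrite enorm0 mulr0 big1// => j _; rewrite mxE mulr0.
have ex : 0 < enorm x.
  by rewrite lt_neqAle enorm_ge0 andbT eq_sym; apply/eqP => /enorm_eq0 /eqP; exact/negP.
have ey : 0 < enorm y.
  by rewrite lt_neqAle enorm_ge0 andbT eq_sym; apply/eqP => /enorm_eq0 /eqP; exact/negP.
have : 0 <= \sum_(j < d) (enorm y * x 0 j - enorm x * y 0 j) ^+ 2.
  by apply: sumr_ge0 => j _; exact: sqr_ge0.
rewrite (eq_bigr (fun j => enorm y ^+ 2 * x 0 j ^+ 2 + enorm x ^+ 2 * y 0 j ^+ 2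
    - (enorm x * enorm y) *+ 2 * (x 0 j * y 0 j))); last first.
  by move=> j _; rewrite sqrrB !exprMn -mulrnAl; ring.
rewrite sumrB big_split/= -!mulr_sumr -!sqr_enorm => h.
have {h} : 0 <= (enorm x * enorm y) * 2 *
    (enorm x * enorm y - \sum_(j < d) x 0 j * y 0 j).
  by apply: le_trans h _; rewrite le_eqVlt; apply/orP; left; apply/eqP; ring.
by rewrite pmulr_rge0 ?subr_ge0// !mulr_gt0.
Qed.

Lemma enormD x y : enorm (x + y) <= enorm x + enorm y.
Proof.
rewrite -(ler_pXn2r (n := 2))// ?nnegrE ?addr_ge0 ?enorm_ge0//.
rewrite sqrrD !sqr_enorm (eq_bigr (fun j => x 0 j ^+ 2 + y 0 j ^+ 2 +
    2 * (x 0 j * y 0 j))); last by move=> j _; rewrite mxE sqrrD; ring.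
rewrite !big_split/= -mulr_sumr addrAC lerD2r lerD2l.
by rewrite -[leRHS]mulr_natl ler_pM2l// enorm_cauchy_schwarz.
Qed.

Lemma enorm_continuous : continuous (@enorm R d).
Proof.
move=> x; apply: (@continuous_comp _ _ _ (fun x : 'rV[R]_d =>
  \sum_(j < d) x 0 j ^+ 2) Num.sqrt); last exact: sqrt_continuous.
apply: (@continuous_big _ _ _ _ _ _ _ _ (fun j (x : 'rV[R]_d) => x 0 j ^+ 2)).
  by move=> [a b]; apply: (@cvgD _ R^o); [exact: cvg_fst|exact: cvg_snd].
move=> j _ {}x; apply: (@continuous_comp _ _ _ (fun x : 'rV[R]_d => x 0 j)
  (fun z : R => z ^+ 2)); first exact: coord_continuous.
exact: exprn_continuous.
Qed.

End enorm_lemmas.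

(* C([t,T]; R^d) paths starting at 0, as functions on the whole line that
   vanish off [t,T]; this normalization makes Leibniz equality of paths the
   equality of their restrictions to [t,T]. *)
Record cpath (R : realType) (d : nat) (T t : R) := CPath {
  cpath_fun :> R -> 'rV[R]_d ;
  cpath_cont : {within `[t, T], continuous cpath_fun} ;
  cpath_start : cpath_fun t = 0 ;
  cpath_out : forall r, ~ `[t, T] r -> cpath_fun r = 0
}.
Arguments cpath_cont {R d T t} _.
Arguments cpath_start {R d T t} _.
Arguments cpath_out {R d T t} _ [r].

Section cpath_structures.
Context {R : realType} {d : nat} {T t : R}.
Local Notation Omega := (cpath d T t).
Implicit Types w : Omega.

HB.instance Definition _ := gen_eqMixin Omega.
HB.instance Definition _ := gen_choiceMixin Omega.

Lemma cpath_eq w1 w2 : cpath_fun w1 = cpath_fun w2 -> w1 = w2.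
Proof.
case: w1 w2 => f c s o [g c' s' o'] /= fg; move: c' s' o'.
rewrite -fg => c' s' o'.
by congr CPath; exact: Prop_irrelevance.
Qed.

Lemma cpath_eqP w1 w2 : (forall r, `[t, T] r -> w1 r = w2 r) -> w1 = w2.
Proof.
move=> h; apply: cpath_eq; apply/funext => r.
have [/h//|nr] := pselect (`[t, T] r).
by rewrite !cpath_out.
Qed.

Lemma cpath0_cont : {within `[t, T], continuous (fun=> 0 : 'rV[R]_d)}.
Proof. by apply: continuous_subspaceT => x; exact: cvg_cst. Qed.

Definition cpath0 : Omega :=
  @CPath R d T t (fun=> 0) cpath0_cont erefl (fun _ _ => erefl).

HB.instance Definition _ := isPointed.Build Omega cpath0.

Definition cpath_dist (w1 w2 : Omega) : R :=
  sup [set enorm (w1 r - w2 r) | r in `[t, T]].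

Lemma cpath_dist_ubound w1 w2 :
  has_ubound [set enorm (w1 r - w2 r) | r in `[t, T]].
Proof.
have /compact_bounded [M [_ HM]] :
    compact [set (enorm (w1 r - w2 r) : R^o) | r in `[t, T]].
  apply: (@continuous_compact _ _ (fun r => enorm (w1 r - w2 r) : R^o));
    last exact: segment_compact.
  have c : {within `[t, T], continuous (fun r => w1 r - w2 r)}.
    by apply: within_continuousB; exact: cpath_cont.
  move=> r; apply: (@continuous_comp (subspace `[t, T]) _ _ _
    (fun x : 'rV[R]_d => enorm x : R^o) r (c r)); exact: enorm_continuous.
exists (M + 1) => _ [r rT <-].
rewrite (le_trans (ler_norm _))//.
by apply: (HM (M + 1)); [rewrite ltrDl|exists r].
Qed.

Lemma cpath_dist_ub w1 w2 r :
  `[t, T] r -> enorm (w1 r - w2 r) <= cpath_dist w1 w2.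
Proof. by move=> rT; apply: ub_le_sup; [exact: cpath_dist_ubound|exists r]. Qed.

Lemma cpath_dist_le w1 w2 M : 0 <= M ->
  (forall r, `[t, T] r -> enorm (w1 r - w2 r) <= M) -> cpath_dist w1 w2 <= M.
Proof.
move=> M0 h; have [S0|S0] := pselect ([set enorm (w1 r - w2 r) | r in `[t, T]] !=set0).
  by apply: ge_sup => // _ [r rT <-]; exact: h.
by rewrite /cpath_dist sup_out// => -[].
Qed.

Lemma cpath_dist_ge0 w1 w2 : 0 <= cpath_dist w1 w2.
Proof.
have [[r rT]|e] := pselect (`[t, T] !=set0).
  exact: le_trans (enorm_ge0 _) (cpath_dist_ub _ _ rT).
rewrite /cpath_dist sup_out// => -[[_ [r rT _]] _].
by apply: e; exists r.
Qed.

Lemma cpath_distxx w : cpath_dist w w = 0.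
Proof.
apply/eqP; rewrite eq_le cpath_dist_ge0 andbT.
by apply: cpath_dist_le => // r _; rewrite subrr enorm0.
Qed.

Lemma cpath_dist_positivity w1 w2 : cpath_dist w1 w2 = 0 -> w1 = w2.
Proof.
move=> h; apply: cpath_eqP => r rT; apply/eqP; rewrite -subr_eq0; apply/eqP.
apply: enorm_eq0; apply/eqP; rewrite eq_le enorm_ge0 andbT -h.
exact: cpath_dist_ub.
Qed.

Lemma cpath_dist_sym w1 w2 : cpath_dist w1 w2 = cpath_dist w2 w1.
Proof.
rewrite /cpath_dist; congr (sup (image _ _)).
by apply/funext => r; rewrite -opprB enormN.
Qed.

Lemma cpath_dist_triangle w2 w1 w3 :
  cpath_dist w1 w3 <= cpath_dist w1 w2 + cpath_dist w2 w3.
Proof.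
apply: cpath_dist_le => [|r rT]; first by rewrite addr_ge0 ?cpath_dist_ge0.
rewrite -(subrKA (w2 r)) (le_trans (enormD _ _))//.
by rewrite lerD// cpath_dist_ub.
Qed.

HB.instance Definition _ := @isMetric.Build R Omega cpath_dist
  cpath_distxx cpath_dist_positivity cpath_dist_sym cpath_dist_triangle.

Let measC := @sigma_algebraC Omega (@open Omega).

HB.instance Definition _ := @isMeasurable.Build (sigma_display (@open Omega))
  Omega <<s @open Omega >> (@sigma_algebra0 _ setT _)
  measC (@sigma_algebra_bigcup _ setT _).

End cpath_structures.

Section cpath_operations.
Context {R : realType} {d : nat} {T : R}.

Section mk_cpath.
Context {t : R}.

Let off (f : R -> 'rV[R]_d) r := if `[< `[t, T] r >] then f r else 0.

Lemma off_in (f : R -> 'rV[R]_d) r : `[t, T] r -> off f r = f r.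
Proof. by rewrite /off => /asboolP ->. Qed.

Lemma off_cont (f : R -> 'rV[R]_d) :
  {within `[t, T], continuous f} -> {within `[t, T], continuous off f}.
Proof.
by apply: subspace_eq_continuous => r; rewrite inE => rT; exact/esym/off_in.
Qed.

Lemma off_start (f : R -> 'rV[R]_d) : f t = 0 -> off f t = 0.
Proof. by rewrite /off; case: ifP. Qed.

Lemma off_out (f : R -> 'rV[R]_d) r : ~ `[t, T] r -> off f r = 0.
Proof. by rewrite /off; case: asboolP. Qed.

(* The element of C([t,T]; R^d) given by f on [t,T], and a dummy path when f
   does not define one. *)
Definition mk_cpath (f : R -> 'rV[R]_d) : cpath d T t :=
  match pselect ({within `[t, T], continuous f} /\ f t = 0) with
  | left h => CPath (off_cont h.1) (off_start h.2) (@off_out f)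
  | right _ => cpath0
  end.

Lemma mk_cpathE (f : R -> 'rV[R]_d) r : {within `[t, T], continuous f} -> f t = 0 ->
  `[t, T] r -> mk_cpath f r = f r.
Proof.
by move=> cf f0 rT; rewrite /mk_cpath; case: pselect => [h|[]//]; exact: off_in.
Qed.

End mk_cpath.

Definition path_Pi (t s : R) (w : cpath d T t) : cpath d T s :=
  mk_cpath (fun r => w r - w s).

Definition path_concat (t s : R) (w : cpath d T t) (w' : cpath d T s) :
    cpath d T t :=
  mk_cpath (fun r => if r < s then w r else w s + w' r).

Lemma path_PiE t s (w : cpath d T t) r : t <= s -> `[s, T] r ->
  path_Pi s w r = w r - w s.
Proof.
move=> ts rT; rewrite mk_cpathE// ?subrr//.
apply: (@within_continuousB _ _ _ `[s, T] w (cst (w s))); last first.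
  by apply: continuous_subspaceT => x; exact: cvg_cst.
apply: (@continuous_subspaceW _ _ _ `[t, T] _ _ (cpath_cont w)) => x /=.
by rewrite !in_itv/= => /andP[sx ->]; rewrite (le_trans ts).
Qed.

Lemma path_concatE t s (w : cpath d T t) (w' : cpath d T s) r :
  t <= s -> s <= T -> `[t, T] r ->
  path_concat w w' r = if r < s then w r else w s + w' r.
Proof.
move=> ts sT rT; rewrite mk_cpathE//; last first.
  case: (ltrP t s) => [_|st]; first exact: cpath_start.
  have {st}e : s = t by apply/eqP; rewrite eq_le st ts.
  by rewrite -{2}e cpath_start e cpath_start addr0.
have -> : `[t, T] = `[t, s] `|` `[s, T] :> set R.
  apply/seteqP; split=> x /=; rewrite !in_itv/=.
    move=> /andP[tx xT]; have [xs|sx] := leP x s; first by left; rewrite tx.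
    by right; rewrite xT ltW.
  by case=> /andP[h1 h2]; apply/andP; split=> //; [exact: le_trans sT|exact: le_trans h1].
apply: withinU_continuous; [exact: interval_closed|exact: interval_closed| |].
  apply: (@subspace_eq_continuous _ _ _ w); last first.
    apply: (@continuous_subspaceW _ _ _ `[t, T] _ _ (cpath_cont w)) => x /=.
    by rewrite !in_itv/= => /andP[-> xs]; rewrite (le_trans xs).
  move=> x; rewrite inE /= in_itv/= => /andP[tx xs]; rewrite /from_subspace.
  have [//|sx] := ltrP x s.
  have -> : x = s by apply/eqP; rewrite eq_le xs sx.
  by rewrite (cpath_start w') addr0.
apply: (@subspace_eq_continuous _ _ _ (cst (w s) + w' : R -> _)); last first.
  apply: within_continuousD; last exact: cpath_cont.
  by apply: continuous_subspaceT => x; exact: cvg_cst.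
by move=> x; rewrite inE /= in_itv/= => /andP[sx _];
  rewrite /from_subspace ltNge sx.
Qed.

Definition cpath_cast (s s' : R) (e : s = s') (w : cpath d T s) :
    cpath d T s' := ecast z (cpath d T z) e w.

(* X^{s,w}; the time argument keeps ranging over the whole line but only times
   in [s,T] matter. *)
Definition path_shift (E : Type) (t s : R) (X : R -> cpath d T t -> E)
    (w : cpath d T t) : R -> cpath d T s -> E :=
  fun r w' => X r (path_concat w w').

End cpath_operations.
Arguments path_shift {R d T E t} s X w.

Definition borel (X : topologicalType) : set_system X := <<s @open X >>.

(* The product of a sigma-algebra on the set D and one on the set E. *)
Definition prod_sigma (X Y : Type) (D : set X) (E : set Y)
    (G : set_system X) (H : set_system Y) : set_system (X * Y) :=
  <<s D `*` E, [set A `*` B | A in G & B in H] >>.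

Definition borel_itv (R : realType) (a b : R) : set_system R :=
  [set A | A `<=` `[a, b] /\ measurable A].

Section filtration.
Context {R : realType} {d : nat} {T t : R}.
Local Notation Omega := (cpath d T t).

Definition Filt (s : R) : set_system Omega :=
  <<s \bigcup_(r in `[t, s])
        preimage_set_system setT (fun w : Omega => w r) (@borel 'rV[R]_d) >>.

Definition progressive : set_system (R * Omega) :=
  [set D | D `<=` `[t, T] `*` setT /\
    forall s, `[t, T] s ->
      prod_sigma `[t, s] setT (borel_itv t s) (Filt s)
        (D `&` (`[t, s] `*` setT))].

Definition stopping_time (tau : Omega -> R) : Prop :=
  (forall w, `[t, T] (tau w)) /\
  (forall s, `[t, T] s -> Filt s [set w | tau w <= s]).

(* The canonical process is a standard Brownian motion: the increment over
   [r,s] is independent of F_r (through E) and has law N(0, (s-r) I_d), i.e.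
   independent N(0, s-r) coordinates; normal_prob takes a standard deviation. *)
Definition is_wiener (P : probability Omega R) : Prop :=
  forall r s, t <= r -> r < s -> s <= T ->
  forall (E : set Omega) (C : 'I_d -> set R),
    Filt r E -> (forall j, measurable (C j)) ->
    P (E `&` [set w : Omega | forall j, C j (w s 0 j - w r 0 j)]) =
    (P E * (\prod_(j < d) fine (normal_prob 0 (Num.sqrt (s - r)) (C j)))%:E)%E.

End filtration.

Definition rational_times (R : realType) (t T : R) : set R :=
  (`[t, T[ `&` [set q | exists p : rat, q = ratr p]) `|` [set T].

Definition separable_space (X : topologicalType) : Prop :=
  exists2 D : set X, countable D & dense D.

Section controls_strategies.
Context {R : realType} {d : nat} {T t : R}.
Local Notation Omega := (cpath d T t).
Local Notation mu := (@lebesgue_measure R).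
Variable P : probability Omega R.

Section controls.
Variables (X : metricType R) (x0 : X) (X0 : set X).

Definition is_control (m : R -> Omega -> X) : Prop :=
  [/\ preimage_set_system (`[t, T] `*` setT) (fun z => m z.1 z.2) (@borel X)
        `<=` progressive,
      {ae (mu \x P)%E, forall z, `[t, T] z.1 -> X0 (m z.1 z.2)}
    & (\int[P]_w \int[mu]_(r in `[t, T]) (mdist (m r w) x0 ^+ 2)%:E < +oo)%E].

End controls.

Section strategies.
Variables (X : metricType R) (x0 : X) (X0 : set X).
Variables (Y : metricType R) (y0 : Y) (Y0 : set Y).

(* Maps X-controls to Y-controls. *)
Definition is_strategy (a : R -> Omega -> X -> Y) : Prop :=
  [/\ preimage_set_system ((`[t, T] `*` setT) `*` setT)
          (fun z => a z.1.1 z.1.2 z.2) (@borel Y)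
        `<=` prod_sigma (`[t, T] `*` setT) setT progressive (@borel X),
      {ae (mu \x P)%E, forall z, `[t, T] z.1 ->
        forall x, X0 x -> Y0 (a z.1 z.2 x)}
    & exists kappa : R, 0 < kappa /\ exists Psi : R -> Omega -> R,
      [/\ forall r w, `[t, T] r -> 0 <= Psi r w,
          preimage_set_system (`[t, T] `*` setT) (fun z => Psi z.1 z.2)
              measurable
            `<=` prod_sigma `[t, T] setT (borel_itv t T) (Filt T),
          (\int[P]_w \int[mu]_(r in `[t, T]) (Psi r w ^+ 2)%:E < +oo)%E
        & {ae (mu \x P)%E, forall z, `[t, T] z.1 -> forall x,
            mdist (a z.1 z.2 x) y0 <= Psi z.1 z.2 + kappa * mdist x x0}]].

Definition is_strategy_hat (a : R -> Omega -> X -> Y) : Prop :=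
  is_strategy a /\
  forall eps : R, 0 < eps -> exists delta : R, 0 < delta /\
    exists F : set Omega,
    [/\ closed F, ((1 - eps)%:E < P F)%E
      & forall w w', F w -> F w' -> mdist w w' < delta ->
        (ereal_sup [set ereal_sup
             (range (fun x => (mdist (a r w x) (a r w' x))%:E))
           | r in `[t, T]] < eps%:E)%E].

End strategies.

End controls_strategies.

(* alpha<nu> and beta<mu> *)
Definition strategy_app (R : realType) (Omega X Y : Type)
    (a : R -> Omega -> X -> Y) (m : R -> Omega -> X) : R -> Omega -> Y :=
  fun r w => a r w (m r w).

(* The pasted map: aa n i (r, Pi(w), x) when r >= tau w and w lies in A n i, and
   a (r, w, x) otherwise; the pair (n, i) is unique when the A n i are pairwise
   disjoint. *)
Definition paste (R : realType) (d : nat) (T t : R) (X Y : Type)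
    (tau : cpath d T t -> R) (N : nat) (tn : nat -> R) (l : 'I_N -> nat)
    (A : forall n : 'I_N, 'I_(l n) -> set (cpath d T t))
    (a : R -> cpath d T t -> X -> Y)
    (aa : forall n : 'I_N, 'I_(l n) -> R -> cpath d T (tn n) -> X -> Y) :
    R -> cpath d T t -> X -> Y :=
  fun r w x =>
    if [pick k : {n : 'I_N & 'I_(l n)} |
          `[< tau w <= r /\ A (tag k) (tagged k) w >]] is Some k
    then aa (tag k) (tagged k) r (path_Pi (tn (tag k)) w) x
    else a r w x.

(* Main.v *)
Require Import Defs.
From HB Require Import structures.
From mathcomp Require Import all_boot all_order all_algebra.
From mathcomp Require Import all_classical all_reals all_analysis.
From mathcomp Require Import measurable_realfun ring lra.

Set Implicit Arguments.
Unset Strict Implicit.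
Unset Printing Implicit Defensive.

Import Order.TTheory GRing.Theory Num.Theory.
Import numFieldNormedType.Exports.

Local Open Scope ring_scope.
Local Open Scope classical_set_scope.

(** Restarting at a time [s] is the map sending [(r, w)] to [(r, path_Pi s w)], from
[[s, T] x Omega^t] to [[s, T] x Omega^s]. On each of the finitely many disjoint
pieces [[t_n, T] x A^n_i] the pasted map is a strategy at [t_n] composed with
such a restart, and elsewhere it is the ambient strategy. So the point is that
all the properties of a strategy are inherited along the restart map.

Measurability. A progressive set is pulled back to a progressive set, because
the restarted path up to time [u] is known at time [u]
([strategy_sigma_restart]); the pieces are progressive since [A^n_i] is known at
time [t_n]. A map that is measurable on each of finitely many measurable pieces
is measurable ([rel_sigma_paste]).

Null sets and square-integrable bounds. They are transported because the law of
[path_Pi s] under the Wiener measure at [t] is the Wiener measure at [s]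
([path_Pi_law]). Both laws have the same increments, so it remains to see that
the increments determine the measure on all Borel sets of the path space
([wiener_unique]): they determine the joint law at finitely many times, by
induction on the number of times, and the coordinates generate the Borel
sigma-algebra since the path space is separable ([borel_Filt]). With the sum of
the growth constants and the pasted square-integrable bounds, this gives
[paste_strategy].

Regularity in the path. The pieces are only measurable, so the pasted map jumps
at their boundary. But a Borel set and its complement contain, up to a small
probability, closed subsets at positive distance from each other
([measurable_separated]). Once the other paths are discarded, two close paths
belong to the same pieces, and the regularity of each strategy applies, the
restart map being Lipschitz ([paste_strategy_hat]).

The identity for the restarted controls. An event known at time [s] does not
distinguish two paths that agree up to [s] ([Filt_agree]), and a stopping time
takes the same value at two paths that agree up to that value
([stopping_time_agree]). Hence concatenating a future at [tau w] changes neither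
[tau] nor the piece, and restarting the concatenated path gives back that
future ([paste_shift_in], [paste_shift_out]). *)

(** * Sigma-algebras relative to a subset *)

Section relative_sigma_algebra.
Context {Z : Type} {D : set Z} {S : set_system Z}.
Hypothesis sS : sigma_algebra D S.

Lemma rel_sigma_setD A : S A -> S (D `\` A).
Proof. by case: sS => _ + _; apply. Qed.

Lemma rel_sigma_setT : S D.
Proof. by have := rel_sigma_setD (let: And3 h _ _ := sS in h); rewrite setD0. Qed.

Lemma rel_sigma_bigcup (F : (set Z)^nat) :
  (forall n, S (F n)) -> S (\bigcup_n F n).
Proof. by case: sS => _ _; apply. Qed.

Lemma rel_sigma_fin_bigcup (K : finType) (F : K -> set Z) :
  (forall k, S (F k)) -> S (\bigcup_k F k).
Proof.
move=> SF; rewrite (_ : \bigcup_k F k = \bigcup_n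
    (if [pick k : K | enum_rank k == n :> nat] is Some k then F k else set0)).
  apply: rel_sigma_bigcup => n; case: pickP => [k _|_]; first exact: SF.
  by case: sS.
apply/seteqP; split=> [z [k _ Fkz]|z [n _]].
  exists (enum_rank k) => //; case: pickP => [k' /eqP/val_inj/enum_rank_inj ->//|].
  by move=> /(_ k); rewrite eqxx.
by case: pickP => // k _ Fkz; exists k.
Qed.

Lemma rel_sigma_setU A B : S A -> S B -> S (A `|` B).
Proof.
move=> SA SB; rewrite -bigcup2E; apply: rel_sigma_bigcup => -[|[|n]]//=.
by case: sS.
Qed.

Lemma rel_sigma_setI A B : A `<=` D -> S A -> S B -> S (A `&` B).
Proof.
move=> AD SA SB; rewrite (_ : A `&` B = D `\` ((D `\` A) `|` (D `\` B))).
  by apply/rel_sigma_setD/rel_sigma_setU; exact: rel_sigma_setD.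
apply/seteqP; split=> z /=.
  by move=> [Az Bz]; split; [exact: AD|case=> -[]].
move=> [Dz /not_orP[h1 h2]].
by split; apply: contrapT => nz; [apply: h1|apply: h2].
Qed.

(** It suffices to look at the generators because the sets with a good preimage are
stable under relative complement and countable union. The map is only used on a
piece [E] of [D], as restarting at [s] makes sense from time [s] on. *)
Lemma rel_sigma_preimage (Y : Type) (D' : set Y) (G : set_system Y)
    (E : set Z) (f : Z -> Y) : S E -> E `<=` D ->
  (forall z, E z -> D' (f z)) ->
  (forall A, G A -> S (E `&` f @^-1` A)) ->
  forall A, <<s D', G >> A -> S (E `&` f @^-1` A).
Proof.
move=> SE ED fE fG; pose C := [set A | S (E `&` f @^-1` A)].
suff : <<s D', G >> `<=` C by [].
apply: smallest_sub => //; split; rewrite /C /=.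
- by rewrite preimage_set0 setI0; case: sS.
- move=> A SA; rewrite (_ : _ `&` _ = E `&` (D `\` (E `&` f @^-1` A))).
    by apply: rel_sigma_setI => //; exact: rel_sigma_setD.
  apply/seteqP; split=> z /=.
    by move=> [Ez [_ nA]]; split=> //; split; [exact: ED|case].
  move=> [Ez [_ nA]]; split=> //; split; first exact: fE.
  by move=> Az; exact: nA.
- move=> F SF; rewrite preimage_bigcup setI_bigcupr.
  exact: rel_sigma_bigcup.
Qed.

Lemma rel_sigma_paste (K : finType) (Y : Type) (E : K -> set Z)
    (f : K -> Z -> Y) (f0 F : Z -> Y) (B : set Y) :
  (forall k, E k `<=` D) -> (forall k, S (E k)) ->
  (forall k, S (E k `&` f k @^-1` B)) -> S (D `&` f0 @^-1` B) ->
  (forall k z, E k z -> F z = f k z) ->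
  (forall z, D z -> (forall k, ~ E k z) -> F z = f0 z) ->
  S (D `&` F @^-1` B).
Proof.
move=> ED SE Sf Sf0 Ff Ff0.
rewrite (_ : _ `&` _ = \bigcup_k (E k `&` f k @^-1` B) `|`
    ((D `&` f0 @^-1` B) `&` (D `\` \bigcup_k E k))).
  apply: rel_sigma_setU; first exact: rel_sigma_fin_bigcup.
  apply: rel_sigma_setI => //; apply: rel_sigma_setD.
  exact: rel_sigma_fin_bigcup.
apply/seteqP; split=> z /=.
  move=> [Dz FB]; have [[k Ekz]|nE] := pselect (exists k, E k z).
    by left; exists k => //; split=> //=; rewrite -(Ff _ _ Ekz).
  right; split; split=> //; last by move=> [k _ Ekz]; apply: nE; exists k.
  by rewrite /preimage/= -Ff0// => k Ekz; apply: nE; exists k.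
case=> [[k _ [Ekz]]|[[Dz f0B] [_ nE]]].
  by rewrite /preimage/= -Ff// => FB; split=> //; exact: ED Ekz.
by split=> //; rewrite Ff0// => k Ekz; apply: nE; exists k.
Qed.

End relative_sigma_algebra.

(** * Events of the past and concatenated paths *)

Section paths.
Context {R : realType} {d : nat} {T : R}.
Implicit Types t s : R.

Lemma Filt_sigma t s : sigma_algebra setT (@Filt R d T t s).
Proof. exact: smallest_sigma_algebra. Qed.

Lemma Filt_coord t s r (B : set 'rV[R]_d) : `[t, s] r -> borel B ->
  @Filt R d T t s [set w | B (w r)].
Proof.
move=> rts bB; apply: sub_gen_smallest; exists r => //; exists B => //.
by rewrite setTI.
Qed.

Lemma Filt_mono t s s' : s <= s' -> @Filt R d T t s `<=` Filt s'.
Proof.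
move=> ss'; apply: sub_smallest2r; first exact: smallest_sigma_algebra.
apply: bigcup_subset => r /=; rewrite !in_itv/= => /andP[-> rs].
exact: le_trans ss'.
Qed.

(** Galmarino's test: the events that do not separate [w] from [w'] form a
sigma-algebra, which contains the generators of the past up to [s]. *)
Lemma Filt_agree t s (E : set (cpath d T t)) (w w' : cpath d T t) : Filt s E ->
  (forall r, `[t, s] r -> w r = w' r) -> E w -> E w'.
Proof.
move=> FE ww'; pose C := [set E : set (cpath d T t) | E w <-> E w'].
suff : Filt s `<=` C by move=> /(_ _ FE)[].
apply: smallest_sub.
  split=> [//|B [BB' B'B]|F FC]; rewrite /C /=.
    by split=> -[_ nB]; split=> // Bw; apply: nB; [exact: B'B|exact: BB'].
  by split=> -[n _ Fn]; exists n => //; have [] := FC n; auto.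
move=> _ [r rts [B _ <-]]; by rewrite /C /= /preimage/= (ww' _ rts).
Qed.

(** The value [tau w] is decided by [w] up to that time: first [tau w' <= tau w],
and then the event [tau <= tau w'] lies in the common past. *)
Lemma stopping_time_agree t (tau : cpath d T t -> R) (w w' : cpath d T t) :
  stopping_time tau -> (forall r, `[t, tau w] r -> w r = w' r) ->
  tau w' = tau w.
Proof.
move=> [tauT tauF] ww'.
have ltau : tau w' <= tau w.
  by apply: (Filt_agree (tauF _ (tauT w)) ww'); rewrite /=.
apply/eqP; rewrite eq_le ltau /=.
apply: (@Filt_agree t (tau w') [set v | tau v <= tau w'] w' w).
- exact: tauF (tauT w').
- move=> r /=; rewrite in_itv/= => /andP[tr rw]; apply/esym/ww'.
  by rewrite /= in_itv/= tr (le_trans rw).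
- exact: lexx.
Qed.

Section concat.
Variables (t s : R) (ts : t <= s) (sT : s <= T).
Implicit Types (w : cpath d T t) (v : cpath d T s).

Lemma path_concat_past w v r : `[t, s] r -> path_concat w v r = w r.
Proof.
rewrite /= in_itv/= => /andP[tr rs].
rewrite path_concatE//; last by rewrite /= in_itv/= tr (le_trans rs).
have [//|sr] := ltrP r s.
have -> : r = s by apply/eqP; rewrite eq_le rs sr.
by rewrite cpath_start addr0.
Qed.

Lemma path_Pi_concat w v : path_Pi s (path_concat w v) = v.
Proof.
apply: cpath_eqP => r; rewrite /= in_itv/= => /andP[sr rT].
rewrite path_PiE//; last by rewrite /= in_itv/= sr.
rewrite !path_concatE//=; rewrite ?in_itv/= ?ts ?sT ?rT ?(le_trans ts)//.
by rewrite ltxx ltNge sr/= cpath_start addr0 addrAC subrr add0r.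
Qed.

End concat.
End paths.

(** * The Borel sigma-algebra of path space *)

Section enorm_facts.
Context {R : realType} {d : nat}.
Implicit Types x : 'rV[R]_d.

Lemma ler_enorm x j : `|x 0 j| <= enorm x.
Proof.
rewrite -(ler_pXn2r (n := 2))// ?nnegrE ?enorm_ge0// sqr_enorm real_normK ?num_real//.
by rewrite (bigD1 j)//= lerDl sumr_ge0// => i _; exact: sqr_ge0.
Qed.

(** The topology of ['rV[R]_d] comes from the sup norm and the distance of paths
from the Euclidean one; this comparison and [ler_enorm] pass from one to the
other. *)
Lemma enorm_small (e : R) : 0 < e -> exists2 r : R, 0 < r &
  forall x, (forall j, `|x 0 j| < r) -> enorm x < e.
Proof.
move=> e0; have /cvgrPdist_lt/(_ _ e0)/nbhs_ballP[r /= r0 rh] :=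
  @enorm_continuous R d 0.
exists r => // x xr; have : ball (0 : 'rV[R]_d) r x.
  by split=> // i j; rewrite ord1 /ball/= mxE sub0r normrN.
by move=> /rh /=; rewrite enorm0 sub0r normrN ger0_norm ?enorm_ge0.
Qed.

Lemma rV_rat_approx x (r : R) : 0 < r ->
  exists q : 'rV[rat]_d, forall j, `|x 0 j - ratr (q 0 j)| < r.
Proof.
move=> r0; have /choice[q qh] j : exists p : rat, `|x 0 j - ratr p| < r.
  have : x 0 j - r < x 0 j + r by rewrite ltrBlDr -addrA ltrDl addr_gt0.
  move=> /rat_in_itvoo[p]; rewrite in_itv/= => /andP[p1 p2].
  by exists p; rewrite distrC ltr_distl p1 p2.
by exists (\row_j q j) => j; rewrite mxE; exact: qh.
Qed.

Lemma natSinv_lt (r : R) : 0 < r -> exists m : nat, m.+1%:R^-1 < r.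
Proof.
move=> r0; have [m _ /(_ m (leqnn m))] := near_infty_natSinv_lt (PosNum r0).
by exists m.
Qed.

(** Open sets of [R^d] are countable unions of boxes with rational centres. *)
Lemma borel_rV_boxes : @borel 'rV[R]_d `<=`
  <<s [set [set x : 'rV[R]_d | forall j, C j (x 0 j)] |
        C in [set C : 'I_d -> set R | forall j, measurable (C j)]] >>.
Proof.
set G := [set _ | C in _].
apply: smallest_sub; first exact: smallest_sigma_algebra.
move=> O oO.
pose box (c : 'rV[rat]_d * nat) := [set x : 'rV[R]_d |
  forall j, ball (ratr (c.1 0 j) : R) (c.2.+1%:R^-1) (x 0 j)].
pose F n := if unpickle n is Some c then
  if `[< box c `<=` O >] then box c else set0 else set0.
have -> : O = \bigcup_n F n.
  apply/seteqP; split=> [x Ox|x [n _]]; last first.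
    by rewrite /F; case: unpickle => // c; case: asboolP => // h /h.
  have /nbhs_ballP[r /= r0 rO] := open_nbhs_nbhs (conj oO Ox).
  have [m mr] : exists m : nat, m.+1%:R^-1 < r / 2.
    by apply: natSinv_lt; rewrite divr_gt0.
  have [q qh] := @rV_rat_approx x m.+1%:R^-1 ltac:(by []).
  exists (pickle (q, m)) => //.
  rewrite /F pickleK; case: asboolP => [_|].
    by move=> j; rewrite /ball/= distrC; exact: qh.
  case=> y yc; apply: rO; split=> // i j; rewrite ord1 [r]splitr /ball/=.
  rewrite -(subrKA (ratr (q 0 j))) (le_lt_trans (ler_normD _ _))// ltrD//.
    by rewrite (lt_trans (qh j)).
  by rewrite (lt_trans _ mr)//; exact: yc.
apply: sigma_algebra_bigcup => n; rewrite /F.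
case: unpickle => [c|]; last exact: sigma_algebra0.
case: ifP => _; last exact: sigma_algebra0.
apply: sub_gen_smallest.
exists (fun j => ball (ratr (c.1 0 j) : R) (c.2.+1%:R^-1)) => // j.
by rewrite ball_itv.
Qed.

Lemma borel_closed_enorm x (r : R) : borel [set y : 'rV[R]_d | enorm (x - y) <= r].
Proof.
have -> : [set y : 'rV[R]_d | enorm (x - y) <= r] =
    setT `\` (fun y => enorm (x - y) : R) @^-1` [set z | r < z].
  apply/seteqP; split=> y /=; last by move=> [_ /negP]; rewrite -leNgt.
  by move=> h; split=> //; apply/negP; rewrite -leNgt.
apply: sigma_algebraCD; apply: sub_gen_smallest.
apply: open_comp; last exact: open_gt.
move=> y _; apply: (@continuous_comp _ _ _ (fun y : 'rV[R]_d => x - y)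
  (fun y : 'rV[R]_d => enorm y : R)); last exact: enorm_continuous.
apply: (@continuousB _ _ _ (cst x) id y).
  exact: cst_continuous.
by move=> A; apply.
Qed.

End enorm_facts.

Section path_borel.
Context {R : realType} {d : nat} {T t : R}.
Local Notation Omega := (cpath d T t).
Implicit Types w : Omega.

Lemma mdistE w w' : mdist w w' = cpath_dist w w'.
Proof. by []. Qed.

Lemma cpath_modulus w r (e : R) : `[t, T] r -> 0 < e -> exists2 z : R, 0 < z &
  forall r', `[t, T] r' -> `|r - r'| < z -> enorm (w r - w r') < e.
Proof.
move=> rT e0; have [z z0 zh] := @enorm_small R d e e0.
have /subspace_continuousP/(_ _ rT) := cpath_cont w.
move=> /cvg_ballP/(_ _ z0); rewrite near_withinE => /nbhs_ballP[u /= u0 uh].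
exists u => // r' r'T rr'; apply: zh => j.
have /= [_ /(_ 0 j)] := uh r' rr' r'T.
by rewrite /ball/= !mxE.
Qed.

(** Heine's theorem by a covering argument: half of the local modulus at a time [r]
serves all the times near [r]. *)
Lemma cpath_unif_modulus w (e : R) : 0 < e -> exists m : nat,
  forall r r', `[t, T] r -> `[t, T] r' -> `|r - r'| <= m.+1%:R^-1 ->
  enorm (w r - w r') < e.
Proof.
move=> e0.
have [] := compact_near_coveringP `[t, T] => /(_ (@segment_compact R t T)) + _.
move=> /(_ nat \oo (fun m r => `[t, T] r -> forall r', `[t, T] r' ->
  `|r - r'| <= m.+1%:R^-1 -> enorm (w r - w r') < e) _).
case=> [r rT|m _ /(_ m (leqnn m)) mh]; last first.
  by exists m => r r' rT; exact: mh.
have e20 : 0 < e / 2 by rewrite divr_gt0.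
have [z z0 zh] := cpath_modulus w rT e20.
have z20 : 0 < z / 2 by rewrite divr_gt0.
exists (ball r (z / 2), [set m | m.+1%:R^-1 < z / 2]) => /=.
  split; first exact: nbhsx_ballx.
  exact: (near_infty_natSinv_lt (PosNum z20)).
move=> [x m] /= [xr mz] xT r' r'T xr'.
rewrite -(subrKA (w r)) (le_lt_trans (enormD _ _))// [e]splitr.
apply: ltrD.
  rewrite -enormN opprB; apply: zh => //.
  by rewrite (lt_trans xr)// [z in _ < z]splitr ltrDl.
apply: zh => //; rewrite -(subrKA x) (le_lt_trans (ler_normD _ _))//.
by rewrite [z]splitr ltrD// (le_lt_trans xr').
Qed.

Lemma coord_continuous_path r : `[t, T] r -> continuous (fun w => w r : 'rV[R]_d).
Proof.
move=> rT w; apply/(@cvg_ballP _ _ _ _ (nbhs_filter w)) => e e0.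
apply/nbhs_ballP; exists e => //= w'.
rewrite ballEmdist/= mdistE => ww'; split=> // i j; rewrite ord1 /ball/=.
apply: le_lt_trans ww'; apply: le_trans (cpath_dist_ub _ _ rT).
by have := ler_enorm (w r - w' r) j; rewrite !mxE.
Qed.

Lemma Filt_measurable s : s <= T -> Filt s `<=` @measurable _ Omega.
Proof.
move=> sT; apply: smallest_sub; first exact: sigma_algebra_measurable.
move=> _ [r /= rts [B bB <-]]; rewrite setTI.
have rT : `[t, T] r.
  by move: rts; rewrite /= !in_itv/= => /andP[-> /le_trans]; apply.
pose C := [set B : set 'rV[R]_d | measurable ((fun w => w r) @^-1` B)].
suff : @borel 'rV[R]_d `<=` C by apply.
apply: smallest_sub => [|O oO]; last first.
  apply: sub_gen_smallest.
  by have /continuousP := coord_continuous_path rT; apply.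
split; rewrite /C/=.
- by rewrite preimage_set0; exact: measurable0.
- by move=> A mA; rewrite setTD preimage_setC; exact: measurableC.
- by move=> F mF; rewrite preimage_bigcup; exact: bigcupT_measurable.
Qed.

(** Clamped rationals form a countable set of times in [[t, T]], dense there, which
contains the end points and makes sense when [t = T]. *)
Definition clamp (x : R) : R := Num.max t (Num.min T x).

Lemma clamp_in x : t <= T -> `[t, T] (clamp x).
Proof.
by move=> tT; rewrite /= in_itv/= /clamp le_max lexx/= ge_max tT ge_min lexx.
Qed.

Lemma clamp_dist r x : `[t, T] r -> `|r - clamp x| <= `|r - x|.
Proof.
rewrite /= in_itv/= => /andP[tr rT]; rewrite /clamp.
case: (leP T x) => Tx.
  rewrite max_r ?(le_trans tr)// !ler0_norm ?subr_le0// ?(le_trans rT)//.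
  by rewrite !opprB lerD2r.
case: (leP t x) => // tx.
rewrite !ger0_norm ?subr_ge0// ?lerD2l ?lerN2 ?(ltW tx)//.
by rewrite (le_trans (ltW tx)).
Qed.

(** A closed ball is cut out by countably many coordinates, as paths are
continuous. *)
Lemma Filt_closed_ball w (q : R) : t <= T -> 0 <= q ->
  Filt T [set w' | cpath_dist w w' <= q].
Proof.
move=> tT q0.
pose F n : set Omega := if unpickle n is Some p then
  [set w' | enorm (w (clamp (ratr p)) - w' (clamp (ratr p))) <= q] else setT.
have -> : [set w' | cpath_dist w w' <= q] = \bigcap_n F n.
  apply/seteqP; split=> [w' /= ww' n _|w' ww' /=].
    rewrite /F; case: unpickle => // p /=.
    by apply: le_trans ww'; apply: cpath_dist_ub; exact: clamp_in.
  apply: cpath_dist_le => // r rT; rewrite leNgt; apply/negP => h.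
  set e := (enorm (w r - w' r) - q) / 2.
  have e0 : 0 < e by rewrite divr_gt0// subr_gt0.
  have [z z0 zh] := cpath_modulus w rT e0.
  have [u u0 uh] := cpath_modulus w' rT e0.
  have v0 : 0 < Num.min z u by rewrite lt_min z0.
  have [p ph] : exists p : rat, `|r - ratr p| < Num.min z u.
    have : r - Num.min z u < r + Num.min z u.
      by rewrite ltrBlDr -addrA ltrDl addr_gt0.
    move=> /rat_in_itvoo[p]; rewrite in_itv/= => /andP[p1 p2].
    by exists p; rewrite distrC ltr_distl p1 p2.
  have cT := clamp_in (ratr p) tT.
  have := le_lt_trans (clamp_dist (ratr p) rT) ph.
  rewrite lt_min => /andP[/(zh _ cT) h1 /(uh _ cT) h2].
  have := ww' (pickle p) I; rewrite /F pickleK /= leNgt => /negP; apply.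
  have : enorm (w r - w' r) <= enorm (w r - w (clamp (ratr p))) +
    (enorm (w (clamp (ratr p)) - w' (clamp (ratr p))) +
     enorm (w' r - w' (clamp (ratr p)))).
    rewrite -[in leRHS](enormN (w' r - _)) opprB.
    rewrite -[X in enorm X](subrKA (w (clamp (ratr p)))).
    rewrite (le_trans (enormD _ _))// lerD2l.
    by rewrite -[X in enorm X <= _](subrKA (w' (clamp (ratr p)))) enormD.
  move=> h3; rewrite ltNge; apply/negP => h4.
  have : enorm (w r - w' r) < e + (q + e).
    by apply: le_lt_trans h3 _; rewrite ltrD// ler_ltD.
  by rewrite addrCA -splitr addrC subrK ltxx.
have -> : \bigcap_n F n = setT `\` \bigcup_n (setT `\` F n).
  by rewrite setTD setC_bigcup; apply: eq_bigcap => // n; rewrite setTD setCK.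
apply: sigma_algebraCD; apply: sigma_algebra_bigcup => n.
apply: sigma_algebraCD; rewrite /F; case: unpickle => [p|].
  apply: (@Filt_coord _ _ _ _ _ _ [set y | enorm (w (clamp (ratr p)) - y) <= q]).
    exact: clamp_in.
  exact: borel_closed_enorm.
exact: rel_sigma_setT (Filt_sigma _ _).
Qed.

End path_borel.

Section path_separable.
Context {R : realType} {d : nat} {T t : R}.
Hypothesis tT : t <= T.
Local Notation Omega := (cpath d T t).
Implicit Types w : Omega.

(** Cells of diameter at most [4/(n+1)], indexed by a countable type, which cover the
path space: bounding the oscillation reduces a path to its values on a grid, and
these are approximated by rational vectors. *)
Definition path_cell (n m : nat) (q : seq 'rV[rat]_d) : set Omega :=
  let x i := t + i%:R / m.+1%:R in
  [set w | [/\ forall r r', `[t, T] r -> `[t, T] r' ->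
                 `|r - r'| <= m.+1%:R^-1 -> enorm (w r - w r') <= n.+1%:R^-1,
     forall i, `[t, T] (x i) -> (i < size q)%N
   & forall i, `[t, T] (x i) ->
       enorm (w (x i) - map_mx ratr (nth 0 q i)) <= n.+1%:R^-1]].

Lemma path_cell_cover n w : exists m q, path_cell n m q w.
Proof.
have e0 : 0 < n.+1%:R^-1 :> R by [].
have [m mh] := cpath_unif_modulus w e0.
have [z z0 zh] := @enorm_small R d _ e0.
pose x i : R := t + i%:R / m.+1%:R.
have /choice[q qh] i : exists q : 'rV[rat]_d,
    enorm (w (x i) - map_mx ratr q) < n.+1%:R^-1.
  have [q qh] := rV_rat_approx (w (x i)) z0.
  by exists q; apply: zh => j; have := qh j; rewrite !mxE.
have m0 : 0 < m.+1%:R :> R by [].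
have xM i : `[t, T] (x i) -> (i < (Num.truncn ((T - t) * m.+1%:R)).+1)%N.
  rewrite /= in_itv/= => /andP[_].
  rewrite /x -lerBrDl ler_pdivrMr// ltnS truncn_ge_nat//.
  by rewrite mulr_ge0// subr_ge0.
exists m, (mkseq q (Num.truncn ((T - t) * m.+1%:R)).+1); split.
- by move=> r r' rT r'T rr'; exact/ltW/mh.
- by move=> i /xM; rewrite size_mkseq.
- by move=> i xi; rewrite nth_mkseq ?xM//; exact/ltW/qh.
Qed.

Lemma path_cell_diam n m q w w' : path_cell n m q w -> path_cell n m q w' ->
  cpath_dist w w' <= 4 / n.+1%:R.
Proof.
move=> [w1 w2 w3] [w1' _ w3']; apply: cpath_dist_le => // r rT.
have m0 : 0 < m.+1%:R :> R by [].
move: (rT); rewrite /= in_itv/= => /andP[tr rTT].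
set i := Num.truncn ((r - t) * m.+1%:R).
have rt0 : 0 <= (r - t) * m.+1%:R by rewrite mulr_ge0// subr_ge0.
have /andP[i1 i2] := truncn_itv rt0.
have x1 : t + i%:R / m.+1%:R <= r by rewrite -lerBrDl ler_pdivrMr.
have x2 : r - (t + i%:R / m.+1%:R) <= m.+1%:R^-1.
  have e : m.+1%:R^-1 + i%:R / m.+1%:R = i.+1%:R / m.+1%:R :> R.
    by rewrite -[i.+1%:R]natr1 mulrDl mul1r addrC.
  by rewrite lerBlDr addrCA -lerBlDl e ler_pdivlMr// ltW.
have xT : `[t, T] (t + i%:R / m.+1%:R).
  by rewrite /= in_itv/= lerDl divr_ge0//= (le_trans x1).
have rx : `|r - (t + i%:R / m.+1%:R)| <= m.+1%:R^-1.
  by rewrite ger0_norm// subr_ge0.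
set x := t + i%:R / m.+1%:R in x1 x2 xT rx.
have e1 := w1 _ _ rT xT rx; have e1' := w1' _ _ rT xT rx.
have e3 := w3 i xT; have e3' := w3' i xT.
set c := map_mx ratr _ in e3 e3'.
have -> : 4 / n.+1%:R = n.+1%:R^-1 + (n.+1%:R^-1 + (n.+1%:R^-1 + n.+1%:R^-1)) :> R.
  by ring.
rewrite -(subrKA (w x)) (le_trans (enormD _ _))// lerD//.
rewrite -(subrKA c) (le_trans (enormD _ _))// lerD//.
rewrite -(subrKA (w' x)) (le_trans (enormD _ _))// lerD//.
  by rewrite -enormN opprB.
by rewrite -enormN opprB.
Qed.

(** Choosing a path in each cell makes every open set a countable union of closed
balls, so that the coordinates generate the Borel sigma-algebra. *)
Lemma borel_Filt : @measurable _ Omega `<=` Filt T.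
Proof.
apply: smallest_sub; first exact: Filt_sigma.
move=> O oO.
pose c (k : nat * nat * seq 'rV[rat]_d) : Omega :=
  xget cpath0 (path_cell k.1.1 k.1.2 k.2).
pose B k := [set w | cpath_dist (c k) w <= 4 / k.1.1.+1%:R].
pose F n := if unpickle n is Some k then
  if `[< B k `<=` O >] then B k else set0 else set0.
have -> : O = \bigcup_n F n.
  apply/seteqP; split=> [w Ow|w [n _]]; last first.
    by rewrite /F; case: unpickle => // k; case: asboolP => // h /h.
  have /nbhs_ballP[e /= e0 eO] := open_nbhs_nbhs (conj oO Ow).
  have [n ne] : exists n : nat, n.+1%:R^-1 < e / 8.
    by apply: natSinv_lt; rewrite divr_gt0.
  have [m [q wq]] := path_cell_cover n w.
  pose k := (n, m, q); have ck : path_cell n m q (c k) by exact: (xgetI _ wq).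
  exists (pickle k) => //; rewrite /F pickleK; case: asboolP => [_|].
    exact: path_cell_diam ck wq.
  case=> w' /= w'B; apply: eO; rewrite ballEmdist/= mdistE.
  apply: le_lt_trans (cpath_dist_triangle (c k) _ _) _.
  apply: le_lt_trans (lerD (path_cell_diam wq ck) w'B) _.
  rewrite -mulrDl -natrD -ltr_pdivlMl// mulrC.
  by rewrite (lt_le_trans ne)// ler_pdivlMr//.
apply: sigma_algebra_bigcup => n; rewrite /F.
case: unpickle => [k|]; last exact: sigma_algebra0.
case: ifP => _; last exact: sigma_algebra0.
by apply: Filt_closed_ball => //; rewrite divr_ge0.
Qed.

End path_separable.

(** * The law of the increments determines the Wiener measure *)

Lemma borel_coord (R : realType) (d : nat) (j : 'I_d) (C : set R) :
  measurable C -> borel [set x : 'rV[R]_d | C (x 0 j)].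
Proof.
pose D := [set C : set R | borel [set x : 'rV[R]_d | C (x 0 j)]].
move=> mC; suff : measurable `<=` D by apply.
rewrite [X in X `<=` _](RGenOpens.measurableE R).
apply: smallest_sub => [|_ [x [y ->]]]; last first.
  apply: sub_gen_smallest.
  have /continuousP := @coord_continuous R 1 d 0 j; apply.
  exact: interval_open.
split.
- exact: sigma_algebra0.
- by move=> A /sigma_algebraCD.
- move=> F DF; rewrite /D/=.
  rewrite (_ : [set x | _] = \bigcup_n [set x : 'rV[R]_d | F n (x 0 j)]).
    by apply: sigma_algebra_bigcup => n; exact: DF.
  by apply/seteqP; split=> x [n _ h]; exists n.
Qed.

Lemma lt_path_bounds (R : realType) (t : R) (s : seq R) :
  path <%R t s -> forall r, r \in t :: s -> t <= r <= last t s.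
Proof.
elim: s t => [t _ r|x s IH t /= /andP[tx xs] r].
  by rewrite inE => /eqP ->; rewrite lexx.
have h := IH x xs.
rewrite inE => /orP[/eqP->|/h/andP[xr rl]]; last by rewrite rl (le_trans (ltW tx)).
by have /andP[_ xl] := h x (mem_head _ _); rewrite lexx (le_trans (ltW tx)).
Qed.

Section wiener_unique.
Context {R : realType} {d : nat} {T t : R}.
Hypothesis tT : t <= T.
Local Notation Omega := (cpath d T t).
Implicit Types (w : Omega) (s : seq R).

Definition times_sigma s : set_system Omega :=
  <<s \bigcup_(r in [set` s])
        preimage_set_system setT (fun w : Omega => w r) (@borel 'rV[R]_d) >>.

Lemma times_sigmaS s s' : {subset s <= s'} -> times_sigma s `<=` times_sigma s'.
Proof.
move=> ss'; apply: sub_smallest2r; first exact: smallest_sigma_algebra.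
by apply: bigcup_subset => r /= /ss'.
Qed.

Lemma times_sigma_Filt s (u : R) : (forall r, r \in s -> `[t, u] r) ->
  times_sigma s `<=` Filt u.
Proof.
move=> su; apply: sub_smallest2r; first exact: smallest_sigma_algebra.
by apply: bigcup_subset => r /= /su.
Qed.

(** All paths start at 0: the start of the induction is a trivial sigma-algebra. *)
Lemma times_sigma_start (E : set Omega) : times_sigma [:: t] E ->
  E = setT \/ E = set0.
Proof.
pose C := [set E : set Omega | forall w w', E w -> E w'].
move=> FE; suff : times_sigma [:: t] `<=` C.
  move=> /(_ _ FE) CE; have [[w Ew]|nE] := pselect (exists w, E w).
    by left; apply/seteqP; split=> // w' _; exact: CE Ew.
  by right; apply/seteqP; split=> // w Ew; apply: nE; exists w.
apply: smallest_sub.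
  split=> [//|A CA w w' [_ nA]|F CF w w' [n _ Fn]].
    by split=> // Aw'; apply: nA; exact: CA Aw'.
  by exists n => //; exact: CF Fn.
move=> _ [r rt [B _ <-]] w w' /=; move: rt; rewrite /= inE => /eqP ->.
by rewrite /preimage/= !cpath_start.
Qed.

Definition incr_event (r u : R) (C : 'I_d -> set R) : set Omega :=
  [set w : Omega | forall j, C j (w u 0 j - w r 0 j)].

Lemma measurable_incr_event r u C : t <= r -> r < u -> u <= T ->
  (forall j, measurable (C j)) -> measurable (incr_event r u C).
Proof.
move=> tr ru uT mC.
have mco z j : `[t, T] z -> measurable_fun setT (fun w => w z 0 j).
  move=> zT _ B mB; rewrite setTI; apply: (Filt_measurable (lexx T)).
  by apply: (@Filt_coord _ _ _ _ _ _ [set x | B (x 0 j)]) => //; exact: borel_coord.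
rewrite (_ : incr_event r u C =
    \bigcap_(j in setT) [set w : Omega | C j (w u 0 j - w r 0 j)]).
  apply: fin_bigcap_measurable => // j _.
  rewrite -[X in measurable X]setTI; apply: measurable_funB => //; apply: mco.
    by rewrite /= in_itv/= uT (le_trans tr (ltW ru)).
  by rewrite /= in_itv/= tr (le_trans (ltW ru)).
by apply/seteqP; split=> w h j => [_|]; exact: h.
Qed.

(** The value at a new time is the last known value plus an increment, so it is
measurable for the sigma-algebra generated by the past and that increment. *)
Lemma times_sigma_rcons s r u : r \in s ->
  times_sigma (rcons s u) `<=`
    <<s [set E `&` incr_event r u C |
          E in times_sigma s & C in [set C | forall j, measurable (C j)]] >>.
Proof.
move=> rs; set H := [set _ | _ in _ & _ in _].
have incrT : incr_event r u (fun=> setT) = setT by apply/seteqP.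
have old : times_sigma s `<=` <<s H >>.
  move=> E sE; apply: sub_gen_smallest.
  by exists E => //; exists (fun=> setT) => //; rewrite incrT setIT.
apply: smallest_sub; first exact: smallest_sigma_algebra.
move=> _ [r' /= + [B bB <-]]; rewrite mem_rcons inE => /orP[/eqP->|r's]; last first.
  by apply: old; apply: sub_gen_smallest; exists r' => //; exists B.
pose M := g_sigma_algebraType H.
have coordM j r0 (C : set R) : r0 \in s -> measurable C ->
    <<s H >> [set w : Omega | C (w r0 0 j)].
  move=> r0s mC; apply: old.
  apply: sub_gen_smallest; exists r0 => //.
  exists [set x | C (x 0 j)]; [exact: borel_coord|exact: setTI].
have mold j : measurable_fun setT (fun w : M => (w : Omega) r 0 j).
  by move=> _ C mC; rewrite setTI; exact: coordM.
have mincr j : measurable_fun setT (fun w : M => (w : Omega) u 0 j - (w : Omega) r 0 j).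
  move=> _ C mC; rewrite setTI; apply: sub_gen_smallest.
  exists setT; first exact: rel_sigma_setT (smallest_sigma_algebra _ _).
  exists (fun i => if i == j then C else setT).
    by move=> i; case: ifP.
  rewrite setTI; apply/seteqP; split=> w /=.
    by move=> /(_ j); rewrite eqxx.
  by move=> h i; case: eqP => // ->.
have mnew j : measurable_fun setT (fun w : M => (w : Omega) u 0 j).
  rewrite (_ : (fun w : M => _) =
    (fun w : M => (w : Omega) r 0 j + ((w : Omega) u 0 j - (w : Omega) r 0 j))).
    exact: measurable_funD.
  by apply/funext => w; rewrite addrC subrK.
rewrite setTI.
pose D := [set B : set 'rV[R]_d | <<s H >> [set w : Omega | B (w u)]].
suff : @borel 'rV[R]_d `<=` D by apply.
apply: (subset_trans (@borel_rV_boxes R d)); apply: smallest_sub.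
  split; rewrite /D/=.
  - exact: sigma_algebra0.
  - by move=> A /sigma_algebraCD.
  - move=> F DF.
    rewrite (_ : [set w : Omega | _] = \bigcup_n [set w : Omega | F n (w u)]).
      by apply: sigma_algebra_bigcup => n; exact: DF.
    by apply/seteqP; split=> w [n _ h]; exists n.
move=> _ [C mC <-]; rewrite /D/=.
rewrite (_ : [set w : Omega | _] = \bigcap_(j in setT) [set w : M | C j ((w : Omega) u 0 j)]).
  apply: (@fin_bigcap_measurable _ M) => // j _.
  by have := mnew j measurableT _ (mC j); rewrite setTI.
by apply/seteqP; split=> w h j => [_|]; exact: h.
Qed.

(** The hypothesis on [m1] and [m2] is what two measures satisfying [is_wiener]
have in common: the mass of an increment given the past is a common factor. *)
Variables m1 m2 : {measure set Omega -> \bar R}.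
Hypothesis m12T : m1 setT = m2 setT.
Hypothesis m1oo : (m1 setT < +oo)%E.
Hypothesis m12 : forall r u, t <= r -> r < u -> u <= T ->
  forall (E : set Omega) (C : 'I_d -> set R),
    Filt r E -> (forall j, measurable (C j)) -> m1 E = m2 E ->
    m1 (E `&` incr_event r u C) = m2 (E `&` incr_event r u C).

Let pi_unique (G : set_system Omega) : setI_closed G -> G setT ->
  G `<=` measurable -> (forall A, G A -> m1 A = m2 A) ->
  forall A, <<s G >> A -> m1 A = m2 A.
Proof.
move=> GI GT mG m12G; apply: (g_sigma_algebra_measure_unique G mG (fun=> setT)) => //.
by apply/seteqP; split=> // w _; exists 0%N.
Qed.

(** Times are added one by one in increasing order. At each step the rectangles
formed by an event of the past and an event on the next increment are stable
under intersection, generate, and have the same mass for both measures. *)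
Lemma sorted_times_unique s : path <%R t s -> (forall r, r \in s -> r <= T) ->
  forall E, times_sigma (t :: s) E -> m1 E = m2 E.
Proof.
elim/last_ind: s => [_ _ E /times_sigma_start[]->//|s u IH].
  by rewrite !measure0.
rewrite rcons_path => /andP[ps su] sT E.
have {}IH := IH ps (fun r rs => sT r (mem_subseq (subseq_rcons s u) rs)).
have bnd := lt_path_bounds ps.
have tl : t <= last t s by have /andP[] := bnd _ (mem_last _ _).
have uT : u <= T by apply: sT; rewrite mem_rcons mem_head.
have sF : times_sigma (t :: s) `<=` Filt (last t s).
  by apply: times_sigma_Filt => r /bnd; rewrite /= in_itv.
rewrite -rcons_cons => /(times_sigma_rcons (mem_last t s)); apply: pi_unique.
- move=> _ _ [E1 sE1 [C1 mC1 <-]] [E2 sE2 [C2 mC2 <-]].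
  exists (E1 `&` E2).
    exact: (rel_sigma_setI (smallest_sigma_algebra _ _)).
  exists (fun j => C1 j `&` C2 j) => [j|]; first exact: measurableI.
  rewrite setIACA; congr (_ `&` _); apply/seteqP; split=> w h.
    by split=> j; have [] := h j.
  by move=> j; split; [exact: h.1|exact: h.2].
- exists setT; first exact: rel_sigma_setT (smallest_sigma_algebra _ _).
  by exists (fun=> setT) => //; rewrite setTI; apply/seteqP.
- move=> _ [E1 /sF E1F [C mC <-]]; apply: measurableI.
    by apply: Filt_measurable E1F; exact: le_trans (ltW su) uT.
  exact: measurable_incr_event.
- by move=> _ [E1 sE1 [C mC <-]]; apply: m12 => //; [exact: sF|exact: IH].
Qed.

(** The sigma-algebras of finitely many times are directed, so their union is stable
under intersection; it generates the Borel sigma-algebra by [borel_Filt]. *)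
Lemma wiener_unique E : measurable E -> m1 E = m2 E.
Proof.
pose G := [set E : set Omega |
  exists2 s, forall r, r \in s -> `[t, T] r & times_sigma s E].
suff GE : forall E, <<s G >> E -> m1 E = m2 E.
  move=> /(borel_Filt tT) FE; apply: GE; apply: FE; split.
    exact: smallest_sigma_algebra.
  move=> _ [r rT [B bB <-]]; apply: sub_gen_smallest; exists [:: r].
    by move=> r'; rewrite inE => /eqP ->.
  by apply: sub_gen_smallest; exists r; [rewrite /= inE|exists B].
apply: pi_unique.
- move=> E1 E2 [s1 s1T E1s] [s2 s2T E2s]; exists (s1 ++ s2).
    by move=> r; rewrite mem_cat => /orP[/s1T|/s2T].
  apply: (rel_sigma_setI (smallest_sigma_algebra _ _)) => //.
    by apply: times_sigmaS E1s => r rs; rewrite mem_cat rs.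
  by apply: times_sigmaS E2s => r rs; rewrite mem_cat rs orbT.
- by exists [::] => //; exact: rel_sigma_setT (smallest_sigma_algebra _ _).
- move=> E1 [s sT sE1]; apply: (Filt_measurable (lexx T)).
  exact: times_sigma_Filt sE1.
- move=> E1 [s sT sE1].
  pose s' := sort <=%R (undup [seq r <- s | t < r]).
  apply: (@sorted_times_unique s').
  + rewrite (path_sortedE lt_trans); apply/andP; split.
      by apply/allP => r; rewrite mem_sort mem_undup mem_filter => /andP[].
    by rewrite lt_sorted_uniq_le sort_uniq undup_uniq sort_le_sorted.
  + move=> r; rewrite mem_sort mem_undup mem_filter => /andP[_ /sT].
    by rewrite /= in_itv/= => /andP[].
  + apply: times_sigmaS sE1 => r rs; rewrite inE mem_sort mem_undup mem_filter rs andbT.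
    by have := sT r rs; rewrite /= in_itv/= le_eqVlt eq_sym => /andP[].
Qed.

End wiener_unique.

(** * The law of the restarted path *)

Section path_Pi_law.
Context {R : realType} {d : nat} {T t s : R}.
Hypotheses (ts : t <= s) (sT : s <= T).
Local Notation Pi := (@path_Pi R d T t s).

Lemma path_Pi_dist (w w' : cpath d T t) :
  mdist (Pi w) (Pi w') <= 2 * mdist w w'.
Proof.
rewrite !mdistE; apply: cpath_dist_le => [|r].
  by rewrite mulr_ge0// cpath_dist_ge0.
rewrite /= in_itv/= => /andP[sr rT].
rewrite !path_PiE//=; rewrite ?in_itv/= ?sr//.
rewrite opprD opprK addrACA mulr_natl mulr2n.
rewrite (le_trans (enormD _ _))// lerD//.
  by apply: cpath_dist_ub; rewrite /= in_itv/= rT (le_trans ts).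
by rewrite -enormN opprD !opprK; apply: cpath_dist_ub; rewrite /= in_itv/= ts.
Qed.

Lemma path_Pi_continuous : continuous Pi.
Proof.
move=> w; apply/(@cvg_ballP _ _ _ _ (nbhs_filter w)) => e e0.
apply/nbhs_ballP; exists (e / 2) => [|w'] /=; first by rewrite divr_gt0.
rewrite !ballEmdist/= => ww'; apply: (le_lt_trans (path_Pi_dist w w')).
by rewrite mulrC -ltr_pdivlMr.
Qed.

Lemma measurable_path_Pi : measurable_fun setT Pi.
Proof.
apply: (measurability (@open (cpath d T s))) => // _ [V oV <-].
rewrite setTI; apply: sub_gen_smallest.
by have /continuousP := path_Pi_continuous; apply.
Qed.

(** The restarted path at time [r] is the increment from [s] to [r], which is known
at time [r]. *)
Lemma Filt_path_Pi u E : s <= u -> u <= T -> Filt u E -> Filt u (Pi @^-1` E).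
Proof.
move=> su uT FE.
suff : Filt u (setT `&` Pi @^-1` E) by rewrite setTI.
apply: (rel_sigma_preimage (Filt_sigma t u) _ _ _ _ FE) => //.
  exact: rel_sigma_setT (Filt_sigma t u).
move=> _ [r /= rsu [B bB <-]]; rewrite !setTI.
move: (rsu); rewrite in_itv/= => /andP[sr ru].
have FC z (j : 'I_d) : `[t, u] z ->
    measurable_fun setT (fun w : g_sigma_algebraType
      (\bigcup_(r in `[t, u]) preimage_set_system setT
         (fun w : cpath d T t => w r) (@borel 'rV[R]_d)) =>
      (w : cpath d T t) z 0 j).
  move=> zu _ C mC; rewrite setTI.
  by apply: (@Filt_coord _ _ _ _ _ _ [set x | C (x 0 j)]) => //; exact: borel_coord.
pose D := [set B : set 'rV[R]_d | @Filt R d T t u [set w | B (Pi w r)]].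
suff : @borel 'rV[R]_d `<=` D by apply.
apply: (subset_trans (@borel_rV_boxes R d)); apply: smallest_sub.
  split; rewrite /D/=.
  - exact: sigma_algebra0.
  - by move=> A /sigma_algebraCD.
  - move=> F DF.
    rewrite (_ : [set w | _] = \bigcup_n [set w | F n (Pi w r)]).
      by apply: sigma_algebra_bigcup => n; exact: DF.
    by apply/seteqP; split=> w [n _ h]; exists n.
move=> _ [C mC <-]; rewrite /D/=.
set M := g_sigma_algebraType _ in FC.
rewrite (_ : [set w | _] =
    \bigcap_(j in setT) [set w : M | C j ((w : cpath d T t) r 0 j -
                                         (w : cpath d T t) s 0 j)]).
  apply: (@fin_bigcap_measurable _ M) => // j _.
  rewrite -[X in measurable X]setTI; apply: (@measurable_funB _ M) => //.
    by apply: FC; rewrite /= in_itv/= ru (le_trans ts).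
  by apply: FC; rewrite /= in_itv/= ts.
apply/seteqP; split=> w h j => [_|].
  by have := h j; rewrite path_PiE//= ?in_itv/= ?sr ?(le_trans ru)// !mxE.
by rewrite path_PiE//= ?in_itv/= ?sr ?(le_trans ru)// !mxE; exact: h.
Qed.

Variables (Pt : probability (cpath d T t) R) (Ps : probability (cpath d T s) R).
Hypotheses (wt : is_wiener Pt) (ws : is_wiener Ps).

(** The increments after [s] of a Brownian motion started at [t] are those of a
Brownian motion started at [s]. *)
Lemma path_Pi_law E : measurable E -> Pt (Pi @^-1` E) = Ps E.
Proof.
pose X : {mfun cpath d T t >-> cpath d T s} :=
  HB.pack Pi (isMeasurableFun.Build _ _ _ _ Pi measurable_path_Pi).
move=> mE; rewrite -[LHS]/(distribution Pt X E).
apply: (wiener_unique sT) mE => /=.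
- by rewrite !probability_setT.
- by rewrite probability_setT ltry.
move=> r u sr ru uT A C FA mC PA.
rewrite [RHS](ws sr ru uT FA mC) -[in RHS]PA.
rewrite -(wt (le_trans ts sr) ru uT (Filt_path_Pi sr (le_trans (ltW ru) uT) FA) mC).
rewrite /distribution /pushforward /= preimage_setI; congr (Pt (_ `&` _)).
apply/seteqP; split=> w h j.
  have := h j; rewrite !path_PiE//= ?in_itv/= ?sr ?uT ?(le_trans (ltW ru))//.
    by rewrite !mxE opprB addrA subrK.
  by rewrite (le_trans sr (ltW ru)).
have := h j; rewrite !path_PiE//= ?in_itv/= ?sr ?uT ?(le_trans (ltW ru))//.
  by rewrite !mxE opprB addrA subrK.
by rewrite (le_trans sr (ltW ru)).
Qed.

Definition restart (z : R * cpath d T t) : R * cpath d T s := (z.1, Pi z.2).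

Lemma measurable_restart : measurable_fun setT restart.
Proof.
apply: measurable_fun_pair; first exact: measurable_fst.
exact: measurableT_comp measurable_path_Pi measurable_snd.
Qed.

Local Notation mu := (@lebesgue_measure R).

(** A null set of the product of Lebesgue and Wiener measures is pulled back to a
null set, since its sections are events whose probability is preserved by
[path_Pi_law]. *)
Lemma ae_restart (Q : R * cpath d T s -> Prop) :
  {ae (mu \x Ps)%E, forall z, Q z} -> {ae (mu \x Pt)%E, forall z, Q (restart z)}.
Proof.
case=> M [mM M0 QM]; exists (restart @^-1` M); split.
- by rewrite -[X in measurable X]setTI; exact: measurable_restart.
- rewrite -M0 /product_measure1; apply: eq_integral => r _ /=.
  transitivity (Pt (Pi @^-1` xsection M r)).
    by congr (Pt _); apply/seteqP; split=> w; rewrite /xsection/= !inE.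
  by apply: path_Pi_law; exact: measurable_xsection.
- by move=> z nQ; apply: QM.
Qed.

Lemma ge0_integral_path_Pi (f : cpath d T s -> \bar R) :
  measurable_fun setT f -> (forall w, 0 <= f w)%E ->
  (\int[Pt]_w f (Pi w) = \int[Ps]_w f w)%E.
Proof.
move=> mf f0.
pose X : {mfun cpath d T t >-> cpath d T s} :=
  HB.pack Pi (isMeasurableFun.Build _ _ _ _ Pi measurable_path_Pi).
have := @ge0_integral_pushforward _ _ _ _ R Pi measurable_path_Pi Pt setT f
  measurableT mf (fun y _ => f0 y).
rewrite preimage_setT => <-.
apply: (@eq_measure_integral _ _ _ _ _ (distribution Pt X)) => A mA _.
exact: path_Pi_law.
Qed.

End path_Pi_law.

(** * Measurability along the restart map *)

Section restart_measurability.
Context {R : realType} {d : nat} {T t s : R}.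
Hypotheses (ts : t <= s) (sT : s <= T).
Local Notation restart := (@restart R d T t s).

Lemma prod_sigma_sigma (X Y : Type) (D : set X) (E : set Y) G H :
  sigma_algebra (D `*` E) (prod_sigma D E G H).
Proof. exact: smallest_sigma_algebra. Qed.

Lemma prod_sigma_setX (X Y : Type) (D : set X) (E : set Y) (G : set_system X)
  (H : set_system Y) A B : G A -> H B -> prod_sigma D E G H (A `*` B).
Proof. by move=> GA HB; apply: sub_gen_smallest; exists A => //; exists B. Qed.

Lemma prod_sigma_restart u E : s <= u -> u <= T ->
  prod_sigma `[s, u] setT (borel_itv s u) (@Filt R d T s u) E ->
  prod_sigma `[t, u] setT (borel_itv t u) (@Filt R d T t u)
    ((`[s, u] `*` setT) `&` restart @^-1` E).
Proof.
move=> su uT.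
have sub : (`[s, u] : set R) `<=` `[t, u].
  by move=> r /=; rewrite !in_itv/= => /andP[/(le_trans ts)-> ->].
apply: (rel_sigma_preimage (prod_sigma_sigma _ _ _ _)).
- apply: prod_sigma_setX; last exact: rel_sigma_setT (Filt_sigma _ _).
  by split=> //; exact: measurable_itv.
- by move=> [r w] /= [/sub].
- by move=> [r w] /= [].
- move=> _ [B [Bsu mB] [F FF <-]].
  rewrite (_ : _ `&` _ = B `*` (path_Pi s @^-1` F)).
    apply: prod_sigma_setX; last exact: Filt_path_Pi.
    by split=> //; exact: subset_trans sub.
  by apply/seteqP; split=> [[r w] /= [_ []]//|[r w] /= [Br Fw]]; split=> //; split=> //; exact: Bsu.
Qed.

(** Before the time [s] the pulled-back set is empty; at a later time [u] it only
depends on the trace of [E] on [[s, u]]. *)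
Lemma progressive_restart (E : set (R * cpath d T s)) : progressive E ->
  progressive ((`[s, T] `*` setT) `&` restart @^-1` E).
Proof.
move=> [ET FE]; split.
  move=> [r w] /= [[]]; rewrite !in_itv/= => /andP[sr rT] _ _.
  by rewrite rT (le_trans ts).
move=> u; rewrite /= in_itv/= => /andP[tu uT].
have [su|us] := leP s u; last first.
  rewrite (_ : _ `&` _ = set0); first exact: sigma_algebra0.
  apply/seteqP; split=> // -[r w] /= [[[]]]; rewrite !in_itv/= => /andP[sr _] _ _.
  by move=> [/andP[_ ru] _]; move: (le_lt_trans (le_trans sr ru) us); rewrite ltxx.
have /(prod_sigma_restart su uT) := FE u ltac:(by rewrite /= in_itv/= su).
congr (prod_sigma _ _ _ _ _); apply/seteqP; split=> -[r w] /=; rewrite !in_itv/=.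
  move=> [[/andP[sr ru] _] [Erw _]].
  by rewrite sr ru (le_trans ru)// (le_trans ts).
by move=> [[[/andP[-> _] _] Erw] [/andP[_ ->] _]].
Qed.

Lemma progressive_rectangle (E : set (cpath d T t)) : Filt s E ->
  progressive (`[s, T] `*` E).
Proof.
move=> FE; split.
  by move=> [r w] /= [+ _]; rewrite !in_itv/= => /andP[sr ->]; rewrite (le_trans ts).
move=> u; rewrite /= in_itv/= => /andP[tu uT].
have [su|us] := leP s u; last first.
  rewrite (_ : _ `&` _ = set0); first exact: sigma_algebra0.
  apply/seteqP; split=> // -[r w] /= [[]]; rewrite !in_itv/= => /andP[sr _] _.
  by move=> [/andP[_ ru] _]; move: (le_lt_trans (le_trans sr ru) us); rewrite ltxx.
rewrite (_ : _ `&` _ = `[s, u] `*` E).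
  apply: prod_sigma_setX; last exact: Filt_mono FE.
  split; last exact: measurable_itv.
  by move=> r /=; rewrite !in_itv/= => /andP[/(le_trans ts)-> ->].
apply/seteqP; split=> -[r w] /=; rewrite !in_itv/=.
  by move=> [[/andP[-> _] Ew] [/andP[_ ->] _]].
by move=> [/andP[sr ru] Ew]; rewrite sr ru (le_trans ru)// (le_trans ts).
Qed.

Lemma strategy_sigma_restart (X : metricType R) E :
  prod_sigma (`[s, T] `*` setT) setT (@progressive R d T s) (@borel X) E ->
  prod_sigma (`[t, T] `*` setT) setT (@progressive R d T t) (@borel X)
    (((`[s, T] `*` setT) `*` setT) `&` (fun z => (restart z.1, z.2)) @^-1` E).
Proof.
apply: (rel_sigma_preimage (prod_sigma_sigma _ _ _ _)).
- apply: prod_sigma_setX.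
    by apply: progressive_rectangle; exact: rel_sigma_setT (Filt_sigma _ _).
  exact: rel_sigma_setT (smallest_sigma_algebra _ _).
- move=> [[r w] x] /= [[+ _] _]; rewrite !in_itv/= => /andP[sr ->].
  by rewrite (le_trans ts).
- by [].
- move=> _ [D pD [C bC <-]].
  rewrite (_ : _ `&` _ = ((`[s, T] `*` setT) `&` restart @^-1` D) `*` C).
    by apply: prod_sigma_setX => //; exact: progressive_restart.
  apply/seteqP; split=> -[[r w] x] /=.
    by move=> [[[rT _] _] [Drw Cx]].
  by move=> [[[rT _] Drw] Cx].
Qed.

End restart_measurability.

(** Square-integrability of a bound is read on the product space, where the
restart map transports it from one Wiener space to the other. *)
Section square_norm.
Context {R : realType} {d : nat} {T t : R}.
Local Notation Omega := (cpath d T t).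
Local Notation mu := (@lebesgue_measure R).
Local Open Scope ereal_scope.

Definition sqr_on (f : R -> Omega -> R) : R * Omega -> \bar R :=
  (fun z => (f z.1 z.2 ^+ 2)%:E) \_ (`[t, T] `*` setT).

Lemma sqr_on_ge0 f z : 0 <= sqr_on f z.
Proof. by rewrite /sqr_on patchE; case: ifP => // _; rewrite lee_fin sqr_ge0. Qed.

Lemma sqr_on_in f r w : `[t, T] r -> sqr_on f (r, w) = (f r w ^+ 2)%:E.
Proof. by move=> rT; rewrite /sqr_on patchE ifT// inE. Qed.

Lemma sqr_on_out f r w : ~ `[t, T] r -> sqr_on f (r, w) = 0.
Proof. by move=> rT; rewrite /sqr_on patchE ifF//; apply/negP; rewrite inE => -[]. Qed.

Lemma measurable_sqr_on f :
  preimage_set_system (`[t, T] `*` setT) (fun z => f z.1 z.2) measurable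
    `<=` prod_sigma `[t, T] setT (borel_itv t T) (@Filt R d T t T) ->
  measurable_fun setT (sqr_on f).
Proof.
move=> mf; have mD : measurable (`[t, T] `*` setT : set (R * Omega)).
  by apply: measurableX => //; exact: measurable_itv.
apply/(measurable_restrictT _ mD); apply/measurable_EFinP.
apply: (@measurable_funX _ _ _ _ (fun z : R * Omega => f z.1 z.2)).
move=> _ B mB; have := mf _ (ex_intro2 _ _ B mB erefl).
apply; split=> [|A [B1 [B1T mB1] [F FF <-]]].
  split=> [|E mE|F mF]; first exact: measurable0.
    exact: measurableD.
  exact: bigcupT_measurable.
by apply: measurableX => //; exact: Filt_measurable FF.
Qed.

Variable P : probability Omega R.

Lemma integral_sqr_on f : measurable_fun setT (sqr_on f) ->
  \int[(mu \x P)]_z sqr_on f z =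
  \int[P]_w \int[mu]_(r in `[t, T]) (f r w ^+ 2)%:E.
Proof.
move=> mf; rewrite fubini_tonelli2//; last by move=> z; exact: sqr_on_ge0.
apply: eq_integral => w _; rewrite /fubini_G [RHS]integral_mkcond.
apply: eq_integral => r _; rewrite patchE; case: ifPn => [|/negP]; rewrite inE.
  exact: sqr_on_in.
exact: sqr_on_out.
Qed.

End square_norm.

Lemma integral_restart (R : realType) (d : nat) (T t s : R)
    (Pt : probability (cpath d T t) R) (Ps : probability (cpath d T s) R)
    (f : R * cpath d T s -> \bar R) :
  t <= s -> s <= T -> is_wiener Pt -> is_wiener Ps ->
  measurable_fun setT f -> (forall z, 0 <= f z)%E ->
  (\int[(@lebesgue_measure R \x Pt)]_z f (restart z) =
   \int[(@lebesgue_measure R \x Ps)]_z f z)%E.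
Proof.
move=> ts sT wt ws mf f0.
rewrite !fubini_tonelli2//; last exact: measurableT_comp mf (measurable_restart ts sT).
rewrite -(ge0_integral_path_Pi ts sT wt ws)//.
  exact: measurable_fun_fubini_tonelli_G.
by move=> w; apply: integral_ge0.
Qed.

(** * Closed approximations at positive distance *)

Lemma fin_pos_lower_bound (R : realType) (I : finType) (f : I -> R) :
  (forall i, 0 < f i) -> exists2 e : R, 0 < e & forall i, e <= f i.
Proof.
move=> f0; exists (\big[Num.min/1]_(i : I) f i).
  exact: lt_bigmin.
by move=> i; exact: bigmin_le_cond.
Qed.

Section closed_approximation.
Context {R : realType} {d : nat} {T t : R}.
Local Notation Omega := (cpath d T t).
Variable P : probability Omega R.
Implicit Types A C : set Omega.

Lemma closed_measurable_path C : closed C -> measurable C.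
Proof.
move=> cC; rewrite -(setCK C); apply: measurableC; apply: sub_gen_smallest.
exact: closed_openC.
Qed.

Lemma decreasing_event_small (F : (set Omega)^nat) (e : R) :
  (forall n, measurable (F n)) -> nonincreasing_seq F -> \bigcap_n F n = set0 ->
  0 < e -> exists n, (P (F n) < e%:E)%E.
Proof.
move=> mF ndF F0 e0.
have : P \o F @ \oo --> P (\bigcap_n F n).
  apply: nonincreasing_cvg_mu => //; last exact: bigcapT_measurable.
  by rewrite (le_lt_trans (probability_le1 _ _))// ltry.
rewrite F0 measure0 => /fine_cvgP[_ /cvgrPdist_lt/(_ _ e0)[n _ /(_ n (leqnn n))]].
rewrite sub0r normrN ger0_norm ?fine_ge0//= => h; exists n.
by rewrite -(fineK (fin_num_measure P _ (mF n))) lte_fin.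
Qed.

Definition separated_approximable A := forall e : R, 0 < e ->
  exists C C' (r : R), [/\ closed C /\ C `<=` A, closed C' /\ C' `<=` ~` A, 0 < r,
    forall w w', C w -> C' w' -> r <= mdist w w'
    & (P (~` (C `|` C')) < e%:E)%E].

(** An open set is exhausted by the points at distance at least [1/(n+1)] from
its complement. *)
Lemma open_separated A : open A -> separated_approximable A.
Proof.
move=> oA e e0.
pose C n := [set w : Omega | forall w', ~ A w' -> n.+1%:R^-1 <= mdist w w'].
have cC n : closed (C n).
  move=> w clw w' nA; apply/ler_addgt0Pl => z z0.
  have [v [Cv wv]] := clw _ (nbhsx_ballx w _ z0).
  move: wv; rewrite ballEmdist/= => wv.
  apply: le_trans (Cv w' nA) _; apply: le_trans (metric_triangle v w w') _.
  by rewrite lerD2r metric_sym ltW.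
have CA n : C n `<=` A.
  move=> w Cw; apply: contrapT => /Cw; rewrite mdistxx leNgt.
  by rewrite invr_gt0 ltr0n.
have [n Pn] : exists n, (P (A `\` C n) < e%:E)%E.
  apply: decreasing_event_small => //.
  - move=> n; apply: measurableD; first exact: sub_gen_smallest.
    exact: closed_measurable_path.
  - move=> m n mn; apply/subsetPset; apply: setDS => w Cw w' /Cw; apply: le_trans.
    by rewrite lef_pV2 ?posrE ?ltr0n// ler_nat.
  - apply/seteqP; split=> // w h; have [Aw _] := h 0%N I.
    have /nbhs_ballP[z /= z0 zA] := open_nbhs_nbhs (conj oA Aw).
    have [n nz] := natSinv_lt z0.
    have [_ []] := h n I; move=> w' nAw'; rewrite leNgt; apply/negP => ww'.
    by apply: nAw'; apply: zA; rewrite ballEmdist/=; exact: lt_trans nz.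
exists (C n), (~` A), n.+1%:R^-1; split=> //.
- by split=> //; exact: open_closedC.
- by move=> w w' Cw; exact: Cw.
- by rewrite setCU setCK setIC -setDE.
Qed.

(** For a countable union, the inner sets are truncated at a finite stage, which
keeps the separation positive, while the outer sets are all intersected. *)
Lemma bigcup_separated (F : (set Omega)^nat) : (forall n, measurable (F n)) ->
  (forall n, separated_approximable (F n)) ->
  separated_approximable (\bigcup_n F n).
Proof.
move=> mF sF e e0.
have e20 : 0 < e / 2 by rewrite divr_gt0.
have en n : 0 < e / 2 / (2 ^ n.+1)%:R by rewrite divr_gt0// ltr0n expn_gt0.
have /choice[C hC] n := sF n _ (en n).
have /choice[C' hC'] := hC; have /choice[r hr] := hC'.
pose D m := \bigcup_n F n `\` \bigcup_(k in `I_m) F k.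
have mD m : measurable (D m).
  apply: measurableD; first exact: bigcupT_measurable.
  by apply: bigcup_measurable => k _; exact: mF.
have [m Pm] : exists m, (P (D m) < (e / 2)%:E)%E.
  apply: decreasing_event_small => //.
    move=> m n mn; apply/subsetPset; apply: setDS; apply: bigcup_subset => k /=.
    by move/leq_trans; apply.
  apply/seteqP; split=> // w h; have [[n _ Fn] _] := h 0%N I.
  by have [_ []] := h n.+1 I; exists n => /=.
have [z z0 zr] : exists2 z : R, 0 < z & forall i : 'I_m, z <= r i.
  by apply: fin_pos_lower_bound => i; have [] := hr i.
exists (\bigcup_(k in `I_m) C k), (\bigcap_n C' n), z; split=> //.
- split.
    by apply: closed_bigcup; [exact: finite_II|move=> k _; have [[]] := hr k].
  move=> w [k _ Ck]; exists k => //.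
  by have [[_ CF] _ _ _ _] := hr k; exact: CF.
- split; first by apply: closed_bigI => k _; have [_ []] := hr k.
  move=> w h [k _ Fk]; have [_ [_ CF] _ _ _] := hr k.
  by apply: (CF w) => //; exact: h.
- move=> w w' [k km Ck] h; have [_ _ _ rk _] := hr k.
  by apply: le_trans (zr (Ordinal km)) _; apply: rk => //; exact: h.
pose B n := ~` (C n `|` C' n).
have mB n : measurable (B n).
  apply: measurableC; apply: measurableU; apply: closed_measurable_path.
    by have [[]] := hr n.
  by have [_ []] := hr n.
have sub : ~` (\bigcup_(k in `I_m) C k `|` \bigcap_n C' n) `<=`
    D m `|` \bigcup_n B n.
  move=> w /not_orP[nC nC'].
  have [|nB] := pselect ((\bigcup_n B n) w); first by right.
  have CC' n : C n w \/ C' n w by apply: contrapT => h; apply: nB; exists n.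
  left; split.
    have /existsNP[n /not_implyP[_ nC'n]] := nC'.
    have [[_ CF] _ _ _ _] := hr n.
    by exists n => //; apply: CF; case: (CC' n).
  move=> [k km Fk]; case: (CC' k) => [Ck|C'k]; first by apply: nC; exists k.
  by have [_ [_ CF] _ _ _] := hr k; exact: (CF _ C'k Fk).
have mE : measurable (~` (\bigcup_(k in `I_m) C k `|` \bigcap_n C' n)).
  apply: measurableC; apply: measurableU.
    apply: bigcup_measurable => k _; apply: closed_measurable_path.
    by have [[]] := hr k.
  apply: bigcapT_measurable => k; apply: closed_measurable_path.
  by have [_ []] := hr k.
have mUB : measurable (\bigcup_n B n) by exact: bigcupT_measurable.
apply: (@le_lt_trans _ _ (P (D m `|` \bigcup_n B n))).
  by apply: le_measure => //; rewrite inE//; exact: measurableU.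
apply: (@le_lt_trans _ _ (P (D m) + P (\bigcup_n B n))%E).
  exact: measureU2.
rewrite [e]splitr EFinD lte_leD//.
  by rewrite fin_num_measure.
apply: (@le_trans _ _ (\sum_(n <oo) P (B n))%E).
  exact: measure_sigma_subadditive.
apply: le_trans (epsilon_trick0 xpredT (ltW e20)).
by apply: lee_nneseries => // n _; apply: ltW; have [] := hr n.
Qed.

Lemma measurable_separated A : measurable A -> separated_approximable A.
Proof.
pose S := [set A | measurable A /\ separated_approximable A].
move=> mA; suff : @measurable _ Omega `<=` S by move=> /(_ _ mA)[].
apply: smallest_sub => [|A' oA]; last first.
  by split; [exact: sub_gen_smallest|exact: open_separated].
split.
- by split; [exact: measurable0|apply: open_separated; exact: open0].
- move=> B [mB sB]; rewrite setTD; split; first exact: measurableC.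
  move=> e e0; have [C [C' [r [h1 h2 r0 h3 h4]]]] := sB e e0.
  exists C', C, r; split=> //.
  + by rewrite setCK.
  + by move=> w w' Cw C'w'; rewrite metric_sym; exact: h3.
  + by rewrite setUC.
- move=> F SF; split; first by apply: bigcupT_measurable => n; have [] := SF n.
  by apply: bigcup_separated => n; have [] := SF n.
Qed.

Lemma probability_fin_bigcap (I : finType) (B : I -> set Omega) (e : R) :
  (forall i, measurable (B i)) -> (forall i, (P (~` B i) <= e%:E)%E) ->
  (P (~` \bigcap_i B i) <= (#|I|%:R * e)%:E)%E.
Proof.
move=> mB PB.
pose F n := if [pick i : I | enum_rank i == n :> nat] is Some i then ~` B i else set0.
have mF n : measurable (F n).
  by rewrite /F; case: pickP => [i _|_]; [exact: measurableC|exact: measurable0].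
have e0 n : (n < #|I|)%N -> (P (F n) <= e%:E)%E.
  move=> nI; rewrite /F; case: pickP => [i _|/(_ (enum_val (Ordinal nI)))].
    exact: PB.
  by rewrite enum_valK eqxx.
apply: (@le_trans _ _ (\sum_(n < #|I|) P (F n))%E).
  apply: content_subadditive => //.
    apply: measurableC; apply: fin_bigcap_measurable => // i _; exact: mB.
  rewrite -bigcup_mkord setC_bigcap => w [i _ nB].
  exists (enum_rank i) => //=; rewrite /F; case: pickP => [j|/(_ i)]; last first.
    by rewrite eqxx.
  by move=> /eqP/val_inj/enum_rank_inj ->.
apply: (@le_trans _ _ (\sum_(n < #|I|) e%:E)%E).
  by apply: lee_sum => n _; exact: e0.
by rewrite sumEFin sumr_const card_ord mulr_natl.
Qed.

End closed_approximation.

(** * Pasting strategies *)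

Lemma ae_fin d (Z : measurableType d) (R : realType)
    (m : {measure set Z -> \bar R}) (I : finType) (Q : I -> Z -> Prop) :
  (forall k, {ae m, forall z, Q k z}) ->
  {ae m, forall z, forall k, Q k z}.
Proof.
move=> h.
have : {ae m, forall z, forall n : nat,
    if [pick k : I | enum_rank k == n :> nat] is Some k then Q k z else True}.
  by apply: ae_foralln => n; case: pickP => [k _|_]; [exact: h|exact: aeW].
apply: filterS => z hz k; have := hz (enum_rank k).
by case: pickP => [k' /eqP/val_inj/enum_rank_inj ->//|/(_ k)]; rewrite eqxx.
Qed.

Lemma ae_prod_filter (R : realType) d (Z : measurableType d) (P : probability Z R) :
  Filter (almost_everywhere (@lebesgue_measure R \x P)%E).
Proof. exact: (ae_filter_ringOfSetsType (@lebesgue_measure R \x P)%E). Qed.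

Section paste.
Context {R : realType} {d : nat} {T t : R}.
Local Notation Omega := (cpath d T t).
Variables (tau : Omega -> R) (N : nat) (tn : nat -> R).
Hypotheses (ttn : forall n, t <= tn n) (tnT : forall n, tn n <= T).
Hypothesis tn_inj : set_inj `I_N tn.
Variables (l : 'I_N -> nat) (A : forall n : 'I_N, 'I_(l n) -> set Omega).
Hypothesis A_meas : forall (n : 'I_N) i, Filt (tn n) (@A n i).
Hypothesis A_tau : forall (n : 'I_N) i w, @A n i w -> tau w = tn n.
Hypothesis A_disj : forall n : 'I_N, trivIset setT (@A n).

Local Notation K := {n : 'I_N & 'I_(l n)}.
Let tk (k : K) := tn (tag k).
Let Ak (k : K) := @A (tag k) (tagged k).

(** Two pieces with distinct indices [n] are disjoint because [tau] separates them,
the [t_n] being distinct. *)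
Lemma piece_unique (k k' : K) w : Ak k w -> Ak k' w -> k = k'.
Proof.
case: k k' => [n i] [n' i']; rewrite /Ak/= => Aw Aw'.
have nn' : n = n'.
  apply: val_inj; apply: tn_inj; rewrite ?inE/= ?ltn_ord//.
  by rewrite -(A_tau Aw) -(A_tau Aw').
move: i' Aw'; rewrite -nn' => i' Aw'; congr existT.
by apply: (A_disj (n := n)) => //; exists w.
Qed.

Section values.
Context {X Y : Type}.
Variables (a : R -> Omega -> X -> Y).
Variables (aa : forall n : 'I_N, 'I_(l n) -> R -> cpath d T (tn n) -> X -> Y).

Lemma paste_in (k : K) r w x : Ak k w -> tk k <= r ->
  paste tau A a aa r w x = @aa (tag k) (tagged k) r (path_Pi (tk k) w) x.
Proof.
move=> Aw kr; rewrite /paste; case: pickP => [k' /asboolP[_ Aw']|].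
  by rewrite (piece_unique (k := k') (k' := k) Aw' Aw).
by move=> /(_ k) /asboolP[]; split=> //; rewrite (A_tau Aw).
Qed.

Lemma paste_out r w x : (forall k : K, ~ (tk k <= r /\ Ak k w)) ->
  paste tau A a aa r w x = a r w x.
Proof.
move=> h; rewrite /paste; case: pickP => // k /asboolP[kr Aw].
by case: (h k); split=> //; rewrite /tk -(A_tau Aw).
Qed.

Lemma paste_dec r w : (exists k : K, tk k <= r /\ Ak k w) \/
  (forall k : K, ~ (tk k <= r /\ Ak k w)).
Proof.
have [h|h] := pselect (exists k : K, tk k <= r /\ Ak k w); first by left.
by right=> k hk; apply: h; exists k.
Qed.

End values.

Lemma piece_choice (S : forall n : 'I_N, 'I_(l n) -> Type)
    (Q : forall (n : 'I_N) (i : 'I_(l n)), S n i -> Prop) :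
  (forall (n : 'I_N) (i : 'I_(l n)), exists x, Q n i x) ->
  exists f : forall (n : 'I_N) (i : 'I_(l n)), S n i, forall n i, Q n i (f n i).
Proof.
by move=> h; exists (fun n i => sval (cid (h n i))) => n i; exact: svalP.
Qed.

Section measurability.
Variables (X Y : metricType R).
Variables (a : R -> Omega -> X -> Y).
Variables (aa : forall n : 'I_N, 'I_(l n) -> R -> cpath d T (tn n) -> X -> Y).

Lemma sub_tn (k : K) : (`[tk k, T] : set R) `<=` `[t, T].
Proof.
by move=> r; rewrite /= !in_itv/= => /andP[kr ->]; rewrite (le_trans (ttn _) kr).
Qed.

Lemma paste_strategy_sigma :
  preimage_set_system ((`[t, T] `*` setT) `*` setT)
      (fun z => a z.1.1 z.1.2 z.2) (@borel Y)
    `<=` prod_sigma (`[t, T] `*` setT) setT (@progressive R d T t) (@borel X) ->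
  (forall (n : 'I_N) i, preimage_set_system ((`[tn n, T] `*` setT) `*` setT)
      (fun z => @aa n i z.1.1 z.1.2 z.2) (@borel Y)
    `<=` prod_sigma (`[tn n, T] `*` setT) setT (@progressive R d T (tn n))
           (@borel X)) ->
  preimage_set_system ((`[t, T] `*` setT) `*` setT)
      (fun z => paste tau A a aa z.1.1 z.1.2 z.2) (@borel Y)
    `<=` prod_sigma (`[t, T] `*` setT) setT (@progressive R d T t) (@borel X).
Proof.
move=> ma maa _ [B bB <-].
pose E (k : K) : set (R * Omega * X) := (`[tk k, T] `*` Ak k) `*` setT.
have ED k : E k `<=` (`[t, T] `*` setT) `*` setT.
  by move=> [[r w] x] /= [[/sub_tn]].
have SE k : prod_sigma (`[t, T] `*` setT) setT (@progressive R d T t) (@borel X) (E k).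
  apply: prod_sigma_setX; last exact: rel_sigma_setT (smallest_sigma_algebra _ _).
  by apply: progressive_rectangle; [exact: ttn|exact: A_meas].
apply: (rel_sigma_paste (prod_sigma_sigma _ _ _ _) (E := E)
  (f := fun k z => @aa (tag k) (tagged k) z.1.1 (path_Pi (tk k) z.1.2) z.2)
  (f0 := fun z => a z.1.1 z.1.2 z.2)) => //.
- move=> k; have := maa (tag k) (tagged k) _ (ex_intro2 _ _ B bB erefl).
  move=> /(strategy_sigma_restart (ttn _)).
  move=> /(rel_sigma_setI (prod_sigma_sigma _ _ _ _) (@ED k) (SE k)).
  congr (prod_sigma _ _ _ _ _); apply/seteqP; split=> -[[r w] x] /=.
    by move=> [Ek [_ [_ ?]]].
  by move=> [[[rT Aw] _] ?].
- by apply: ma; exists B.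
- move=> k [[r w] x] /= [[+ Aw] _]; rewrite /= in_itv/= => /andP[kr _].
  exact: paste_in.
- move=> [[r w] x] /= [[rT _] _] nE; apply: paste_out => k [kr Aw].
  apply: (nE k); split=> //; split=> //.
  by move: rT; rewrite /= !in_itv/= kr => /andP[].
Qed.

End measurability.

Lemma paste_process_sigma (f : R -> Omega -> R)
    (g : forall n : 'I_N, 'I_(l n) -> R -> cpath d T (tn n) -> R) :
  preimage_set_system (`[t, T] `*` setT) (fun z => f z.1 z.2) measurable
    `<=` prod_sigma `[t, T] setT (borel_itv t T) (@Filt R d T t T) ->
  (forall (n : 'I_N) i, preimage_set_system (`[tn n, T] `*` setT)
      (fun z => @g n i z.1 z.2) measurable
    `<=` prod_sigma `[tn n, T] setT (borel_itv (tn n) T) (@Filt R d T (tn n) T)) ->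
  preimage_set_system (`[t, T] `*` setT)
      (fun z => paste tau A (fun r w _ => f r w) (fun n i r w _ => @g n i r w)
                  z.1 z.2 tt) measurable
    `<=` prod_sigma `[t, T] setT (borel_itv t T) (@Filt R d T t T).
Proof.
move=> mf mg _ [B bB <-].
pose E (k : K) : set (R * Omega) := `[tk k, T] `*` Ak k.
have ED k : E k `<=` `[t, T] `*` setT by move=> [r w] /= [/sub_tn].
have SE k : prod_sigma `[t, T] setT (borel_itv t T) (@Filt R d T t T) (E k).
  apply: prod_sigma_setX; last by apply: (Filt_mono (tnT (tag k))); exact: A_meas.
  by split; [exact: sub_tn|exact: measurable_itv].
apply: (rel_sigma_paste (prod_sigma_sigma _ _ _ _) (E := E)
  (f := fun k z => @g (tag k) (tagged k) z.1 (path_Pi (tk k) z.2))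
  (f0 := fun z => f z.1 z.2)) => //.
- move=> k; have := mg (tag k) (tagged k) _ (ex_intro2 _ _ B bB erefl).
  move=> /(prod_sigma_restart (ttn _) (tnT _) (lexx T)).
  move=> /(rel_sigma_setI (prod_sigma_sigma _ _ _ _) (@ED k) (SE k)).
  congr (prod_sigma _ _ _ _ _); apply/seteqP; split=> -[r w] /=.
    by move=> [Ek [_ [_ ?]]].
  by move=> [[rT Aw] ?].
- by apply: mf; exists B.
- move=> k [r w] /= [+ Aw]; rewrite /= in_itv/= => /andP[kr _].
  by rewrite (paste_in _ _ _ Aw).
- move=> [r w] /= [rT _] nE; apply: paste_out => k [kr Aw].
  apply: (nE k); split=> //.
  by move: rT; rewrite /= !in_itv/= kr => /andP[].
Qed.

(** Concatenating a future at time [tau w] changes neither [tau] nor the pieces that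
contain [w], as both are decided by the past; the identities below thus hold for
every path [w]. *)
Section shift.
Hypotheses (tau_stop : stopping_time tau).
Context {X Y : Type}.
Variables (a : R -> Omega -> X -> Y).
Variables (aa : forall n : 'I_N, 'I_(l n) -> R -> cpath d T (tn n) -> X -> Y).
Variable m : R -> Omega -> X.

Lemma path_concat_cast (s s' : R) (e : s = s') (w : Omega) (v : cpath d T s) :
  path_concat w (cpath_cast e v) = path_concat w v.
Proof. by case: s' / e. Qed.

Lemma path_Pi_concat_cast (s s' : R) (e : s = s') (w : Omega) (v : cpath d T s) :
  t <= s -> s <= T -> path_Pi s' (path_concat w v) = cpath_cast e v.
Proof. by case: s' / e => ts sT; exact: path_Pi_concat. Qed.

Let tau_itv w : t <= tau w /\ tau w <= T.
Proof. by have := tau_stop.1 w; rewrite /= in_itv/= => /andP[]. Qed.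

Lemma paste_shift_in (n : 'I_N) (i : 'I_(l n)) w (Aw : @A n i w) r
    (v : cpath d T (tau w)) : tau w <= r ->
  path_shift (tau w) (strategy_app (paste tau A a aa) m) w r v =
  strategy_app (@aa n i) (path_shift (tn n) m w) r (cpath_cast (A_tau Aw) v).
Proof.
move=> wr; have [tw wT] := tau_itv w.
have Awv : Ak (Tagged _ i) (path_concat w v).
  apply: (Filt_agree (A_meas i) _ Aw) => z; rewrite -(A_tau Aw) => zw.
  by rewrite path_concat_past.
have nr : tk (Tagged _ i) <= r by rewrite /tk/= -(A_tau Aw).
rewrite /path_shift /strategy_app (paste_in _ _ _ Awv nr)/=.
by rewrite (path_Pi_concat_cast (A_tau Aw))// path_concat_cast.
Qed.

Lemma paste_shift_out w r (v : cpath d T (tau w)) :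
  (forall (n : 'I_N) i, ~ @A n i w) ->
  path_shift (tau w) (strategy_app (paste tau A a aa) m) w r v =
  path_shift (tau w) (strategy_app a m) w r v.
Proof.
move=> nA; have [tw wT] := tau_itv w.
have past z : `[t, tau w] z -> w z = path_concat w v z.
  by move=> zw; rewrite path_concat_past.
have tauv := stopping_time_agree tau_stop past.
rewrite /path_shift /strategy_app paste_out// => -[n i] [_ Av]; apply: (nA n i).
apply: (Filt_agree (A_meas i) _ Av) => z; rewrite -(A_tau Av) tauv => zw.
by rewrite -past.
Qed.

End shift.

Section strategies.
Variable P : forall s : R, probability (cpath d T s) R.
Hypotheses (Pt_wiener : is_wiener (P t)) (Ptn_wiener : forall n, is_wiener (P (tn n))).
Local Notation mu := (@lebesgue_measure R).

Lemma ae_pieces (Q : forall n : 'I_N, 'I_(l n) -> R * cpath d T (tn n) -> Prop) :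
  (forall (n : 'I_N) i, {ae (mu \x P (tn n))%E, forall z, @Q n i z}) ->
  {ae (mu \x P t)%E, forall z, forall k : K, @Q (tag k) (tagged k) (restart z)}.
Proof.
move=> h; apply: ae_fin => k.
have h1 := ae_restart (ttn _) (tnT _) Pt_wiener (@Ptn_wiener _) (h (tag k) (tagged k)).
exact: h1.
Qed.

(** The square of a pasted process is at most the sum of the squares of all the
processes involved, each extended by 0 before its starting time. *)
Lemma paste_square_integrable (f : R -> Omega -> R)
    (g : forall n : 'I_N, 'I_(l n) -> R -> cpath d T (tn n) -> R) :
  let h r w := paste tau A (fun r w _ => f r w) (fun n i r w _ => @g n i r w)
                 r w tt in
  measurable_fun setT (@sqr_on R d T t f) ->
  (forall (n : 'I_N) i, measurable_fun setT (sqr_on (@g n i))) ->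
  measurable_fun setT (@sqr_on R d T t h) ->
  (\int[P t]_w \int[mu]_(r in `[t, T]) (f r w ^+ 2)%:E < +oo)%E ->
  (forall (n : 'I_N) i, \int[P (tn n)]_w \int[mu]_(r in `[(tn n), T])
                 (@g n i r w ^+ 2)%:E < +oo)%E ->
  (\int[P t]_w \int[mu]_(r in `[t, T]) (h r w ^+ 2)%:E < +oo)%E.
Proof.
move=> h mf mg mh; rewrite -!integral_sqr_on// => foo goo.
pose G (k : K) : R * Omega -> \bar R :=
  fun z => sqr_on (@g (tag k) (tagged k)) (restart z).
have mG k : measurable_fun setT (G k).
  exact: (measurableT_comp (mg _ (tagged k)) (measurable_restart (ttn _) (tnT _))).
have G0 k z : (0 <= G k z)%E by exact: sqr_on_ge0.
have Goo k : (\int[mu \x P t]_z G k z < +oo)%E.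
  rewrite (integral_restart (ttn _) (tnT _) Pt_wiener (@Ptn_wiener _))//.
  - by rewrite integral_sqr_on//; exact: goo.
  - by move=> z; exact: sqr_on_ge0.
have sum0 (Q : pred K) z : (0 <= \sum_(k : K | Q k) G k z)%E.
  by apply: sume_ge0 => k _; exact: G0.
have le_h z : (sqr_on h z <= sqr_on f z + \sum_(k : K) G k z)%E.
  case: z => r w; have [rT|rT] := pselect (`[t, T] r); last first.
    by rewrite sqr_on_out//; apply: adde_ge0; [exact: sqr_on_ge0|exact: sum0].
  rewrite sqr_on_in// /h.
  have [[k [kr Aw]]|nA] := paste_dec r w.
    have Gk : G k (r, w) = (@g (tag k) (tagged k) r (path_Pi (tk k) w) ^+ 2)%:E.
      rewrite /G /restart/= sqr_on_in//.
      by move: rT; rewrite /= !in_itv/= kr => /andP[].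
    rewrite (paste_in _ _ _ Aw kr) (bigD1 k)//= addeCA -Gk; apply: leeDl.
    by apply: adde_ge0; [exact: sqr_on_ge0|exact: sum0].
  rewrite paste_out//.
  by rewrite -(sqr_on_in f w rT); apply: leeDl; exact: sum0.
have msum : measurable_fun setT (fun z => \sum_(k : K) G k z)%E.
  by apply: emeasurable_fun_sum => k; exact: mG.
apply: (@le_lt_trans _ _ (\int[mu \x P t]_z (sqr_on f z + \sum_(k : K) G k z))%E).
  apply: ge0_le_integral => //.
  - by move=> z _; exact: sqr_on_ge0.
  - exact: emeasurable_funD.
rewrite ge0_integralD//; last by move=> z _; exact: sqr_on_ge0.
rewrite lte_add_pinfty// ge0_integral_sum//.
by apply: lte_sum_pinfty => k _; exact: Goo.
Qed.

Section metric.
Variables (X : metricType R) (x0 : X) (X0 : set X).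
Variables (Y : metricType R) (y0 : Y) (Y0 : set Y).
Variables (a : R -> Omega -> X -> Y).
Variables (aa : forall n : 'I_N, 'I_(l n) -> R -> cpath d T (tn n) -> X -> Y).

(** The growth condition holds with the pasted bounds [Psi] and the sum of the
constants [kappa]: finitely many pieces are involved. *)
Lemma paste_strategy : is_strategy (P t) x0 X0 y0 Y0 a ->
  (forall (n : 'I_N) i, is_strategy (P (tn n)) x0 X0 y0 Y0 (@aa n i)) ->
  is_strategy (P t) x0 X0 y0 Y0 (paste tau A a aa).
Proof.
move=> [ma a0 [ka [ka0 [Psi [Psi0 mPsi iPsi leP]]]]] saa.
have FF := ae_prod_filter (P t).
split.
- by apply: paste_strategy_sigma => // n i; have [] := saa n i.
- have := ae_pieces (fun n i => let: And3 _ h _ := saa n i in h).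
  apply: filterS2 a0 => -[r w] /= az aaz rT x Xx.
  have [[k [kr Aw]]|nA] := paste_dec r w.
    rewrite (paste_in _ _ _ Aw kr); apply: aaz => //.
    by move: rT; rewrite !in_itv/= kr => /andP[].
  by rewrite paste_out//; exact: az.
have [kap kh] := piece_choice (fun n i => let: And3 _ _ h := saa n i in h).
have [Ps Ph] := piece_choice (fun n i => (kh n i).2).
have kap0 (k : K) : 0 < kap (tag k) (tagged k) by exact: (kh _ _).1.
have sk0 (Q : pred K) : 0 <= \sum_(k : K | Q k) kap (tag k) (tagged k).
  by apply: sumr_ge0 => k _; exact/ltW/kap0.
exists (ka + \sum_(k : K) kap (tag k) (tagged k)); split.
  by rewrite ltr_wpDr.
exists (fun r w => paste tau A (fun r w _ => Psi r w) (fun n i r w _ => Ps n i r w) r w tt).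
have mpaste := @paste_process_sigma Psi Ps mPsi
  (fun n i => let: And4 _ h _ _ := Ph n i in h).
split.
- move=> r w rT.
  have [[k [kr Aw]]|nA] := paste_dec r w.
    rewrite (paste_in _ _ _ Aw kr); have [+ _ _ _] := Ph (tag k) (tagged k); apply.
    by move: rT; rewrite /= !in_itv/= kr => /andP[].
  by rewrite paste_out//; exact: Psi0.
- exact: mpaste.
- apply: paste_square_integrable => //.
  + exact: measurable_sqr_on.
  + by move=> n i; apply: measurable_sqr_on; have [] := Ph n i.
  + exact: measurable_sqr_on.
  + by move=> n i; have [] := Ph n i.
- have := ae_pieces (fun n i => let: And4 _ _ _ h := Ph n i in h).
  apply: filterS2 leP => -[r w] /= az aaz rT x.
  have [[k [kr Aw]]|nA] := paste_dec r w.
    rewrite !(paste_in _ _ _ Aw kr).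
    have /le_trans : mdist (@aa (tag k) (tagged k) r (path_Pi (tk k) w) x) y0 <=
        Ps (tag k) (tagged k) r (path_Pi (tk k) w) + kap (tag k) (tagged k) * mdist x x0.
      by apply: aaz; move: rT; rewrite !in_itv/= kr => /andP[].
    apply; rewrite lerD2l ler_wpM2r ?mdist_ge0// (bigD1 k)//= addrCA lerDl.
    by rewrite addr_ge0// ltW.
  rewrite !paste_out//.
  apply: le_trans (az rT x) _.
  by rewrite lerD2l ler_wpM2r ?mdist_ge0// lerDl.
Qed.

(** The indicators of the pieces are discontinuous, so besides the closed sets given
for each strategy one keeps, for each piece, only the paths of two closed sets at
positive distance, one inside and one outside the piece. Two close paths that
are kept use the same strategy, at the same times. *)
Lemma paste_strategy_hat : is_strategy_hat (P t) x0 X0 y0 Y0 a ->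
  (forall (n : 'I_N) i, is_strategy_hat (P (tn n)) x0 X0 y0 Y0 (@aa n i)) ->
  is_strategy_hat (P t) x0 X0 y0 Y0 (paste tau A a aa).
Proof.
move=> [sa ha] haa; split.
  by apply: paste_strategy => // n i; have [] := haa n i.
move=> eps eps0.
(* one closed set for the ambient strategy and two for each piece; each of these
#|J| sets may miss a mass e, and e < eps / #|J| keeps the total strictly below
eps *)
pose J : finType := option (K * bool).
pose e : R := eps / #|J|.+1%:R.
have e0 : 0 < e by rewrite divr_gt0.
have e_eps : e < eps by rewrite ltr_pdivrMr// ltr_pMr// ltr1n card_option.
have [r [r0 [F [cF PF Fa]]]] := ha e e0.
have [rk hrk] := piece_choice (fun n i => (haa n i).2 e e0).
have [Fk hFk] := piece_choice (fun n i => (hrk n i).2).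
have sep (k : K) : separated_approximable (P t) (Ak k).
  apply: measurable_separated; apply: (Filt_measurable (tnT (tag k))).
  exact: A_meas.
have /choice[C hC] k := sep k e e0.
have /choice[C' hC'] := hC; have /choice[q hq] := hC'.
pose B (i : J) : set Omega := match i with
  | None => F
  | Some (k, true) => path_Pi (tk k) @^-1` (@Fk (tag k) (tagged k))
  | Some (k, false) => C k `|` C' k
  end.
pose z (i : J) : R := match i with
  | None => r
  | Some (k, true) => @rk (tag k) (tagged k) / 2
  | Some (k, false) => q k
  end.
have [m m0 mz] : exists2 m, 0 < m & forall i, m <= z i.
  apply: fin_pos_lower_bound => -[[k []]|] //=.
    by rewrite divr_gt0//; exact: (hrk _ _).1.
  by have [] := hq k.
have cB i : closed (B i).
  case: i => [[k []]|] //=.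
    have /continuous_closedP := @path_Pi_continuous R d T t (tk k) (ttn _) (tnT _).
    by apply; have [] := hFk (tag k) (tagged k).
  by apply: closedU; have [[? ?] [? ?]] := hq k.
have PB i : (P t (~` B i) <= e%:E)%E.
  have main d0 (Z : measurableType d0) (Q : probability Z R) (E : set Z) :
      measurable E -> ((1 - e)%:E < Q E)%E -> (Q (~` E) <= e%:E)%E.
    move=> mE; rewrite probability_setC// -(fineK (fin_num_measure Q _ mE)).
    by rewrite lte_fin -EFinB lee_fin => /ltW; rewrite lerBlDr addrC -lerBlDr.
  case: i => [[k []]|] /=.
  - rewrite preimage_setC (path_Pi_law (ttn _) (tnT _) Pt_wiener (@Ptn_wiener _)).
      apply: main; last by have [] := hFk (tag k) (tagged k).
      by apply: closed_measurable_path; have [] := hFk (tag k) (tagged k).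
    apply: measurableC; apply: closed_measurable_path.
    by have [] := hFk (tag k) (tagged k).
  - by apply: ltW; have [] := hq k.
  - by apply: main => //; exact: closed_measurable_path.
exists m; split=> //; exists (\bigcap_i B i); split.
- by apply: closed_bigI => i _; exact: cB.
- have mB : measurable (\bigcap_i B i).
    by apply: closed_measurable_path; apply: closed_bigI => i _; exact: cB.
  have := probability_fin_bigcap (fun i => closed_measurable_path (cB i)) PB.
  rewrite probability_setC// -(fineK (fin_num_measure (P t) _ mB)).
  rewrite -EFinB lee_fin lte_fin => h.
  rewrite ltrBlDl -ltrBlDr; apply: le_lt_trans h _.
  by rewrite /e mulrCA -[ltRHS]mulr1 ltr_pM2l// ltr_pdivrMr// mul1r ltr_nat.
move=> w w' Bw Bw' ww'.
(* two paths of the closed set lie in the same pieces, being closer to each other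
than the closed sets inside and outside each piece *)
have same (k : K) v v' : (\bigcap_i B i) v -> (\bigcap_i B i) v' ->
    mdist v v' < m -> Ak k v -> Ak k v'.
  move=> Bv Bv' vv' Av; have [[_ CA] [_ CA'] q0 qk _] := hq k.
  have [Cv|/CA'//] : (C k `|` C' k) v := Bv (Some (k, false)) I.
  have [/CA//|C'v'] : (C k `|` C' k) v' := Bv' (Some (k, false)) I.
  have := le_trans (mz (Some (k, false))) (qk _ _ Cv C'v').
  by rewrite leNgt vv'.
apply: le_lt_trans (_ : e%:E < _)%E; last by rewrite lte_fin.
apply: ge_ereal_sup => _ [u uT <-].
have [[k [ku Aw]]|nA] := paste_dec u w.
  have Aw' := same k _ _ Bw Bw' ww' Aw.
  have [_ _ /(_ (path_Pi (tk k) w) (path_Pi (tk k) w'))] := hFk (tag k) (tagged k).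
  move=> /(_ (Bw (Some (k, true)) I) (Bw' (Some (k, true)) I)) hk.
  apply: le_trans (ltW (hk _)); last first.
    apply: le_lt_trans (path_Pi_dist (ttn _) (tnT _) w w') _.
    rewrite mulrC -ltr_pdivlMr//; apply: lt_le_trans ww' _.
    exact: (mz (Some (k, true))).
  apply: ereal_sup_ubound; exists u.
    by move: uT; rewrite /= !in_itv/= ku => /andP[].
  congr ereal_sup; apply: eq_imagel => x _ /=.
  by rewrite (paste_in _ _ _ Aw ku) (paste_in _ _ _ Aw' ku).
have nA' (k : K) : ~ (tk k <= u /\ Ak k w').
  move=> [ku Aw']; apply: (nA k); split=> //.
  by apply: same Aw' => //; rewrite metric_sym.
apply: le_trans (ltW (Fa w w' (Bw None I) (Bw' None I) _)); last first.
  exact: lt_le_trans (mz None).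
apply: ereal_sup_ubound; exists u => //.
congr ereal_sup; apply: eq_imagel => x _ /=.
by rewrite !paste_out.
Qed.

End metric.
End strategies.
End paste.

(** * The pasted strategy *)

Theorem proposition4p10 (R : realType) (d : nat) (T : R) (T_gt0 : 0 < T)
  (P : forall s : R, probability (cpath d T s) R)
  (P_wiener : forall s, `[0, T] s -> is_wiener (P s))
  (U : metricType R) (U_sep : separable_space U) (u0 : U)
  (U0 : set U) (U0_neq0 : U0 !=set0)
  (V : metricType R) (V_sep : separable_space V) (v0 : V)
  (V0 : set V) (V0_neq0 : V0 !=set0)
  (t : R) (t_in : `[0, T] t)
  (tau : cpath d T t -> R) (tau_stop : stopping_time tau)
  (tn : nat -> R) (tn_rat : forall n, rational_times t T (tn n))
  (tau_tn : forall w, range tn (tau w))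
  (N : nat) (tn_inj : set_inj `I_N tn)
  (l : 'I_N -> nat)
  (A : forall n : 'I_N, 'I_(l n) -> set (cpath d T t))
  (A_meas : forall (n : 'I_N) i, Filt (tn n) (A n i))
  (A_tau : forall (n : 'I_N) i w, A n i w -> tau w = tn n)
  (A_disj : forall n : 'I_N, trivIset setT (A n)) :
  let A0 := ~` \bigcup_n \bigcup_i A n i in
  (forall (a : R -> cpath d T t -> V -> U)
      (aa : forall n : 'I_N, 'I_(l n) -> R -> cpath d T (tn n) -> V -> U),
    let ahat := paste tau A a aa in
    (is_strategy (P t) v0 V0 u0 U0 a ->
     (forall (n : 'I_N) i, is_strategy (P (tn n)) v0 V0 u0 U0 (aa n i)) ->
     is_strategy (P t) v0 V0 u0 U0 ahat /\
     forall nu, is_control (P t) v0 V0 nu ->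
       {ae P t, forall w, forall r, `[tau w, T] r ->
         (forall (n : 'I_N) i (Aw : A n i w) (w' : cpath d T (tau w)),
           path_shift (tau w) (strategy_app ahat nu) w r w' =
           strategy_app (aa n i) (path_shift (tn n) nu w) r (cpath_cast (A_tau n i w Aw) w')) /\
         (A0 w -> forall w' : cpath d T (tau w),
           path_shift (tau w) (strategy_app ahat nu) w r w' = path_shift (tau w) (strategy_app a nu) w r w')}) /\
    (is_strategy_hat (P t) v0 V0 u0 U0 a ->
     (forall (n : 'I_N) i, is_strategy_hat (P (tn n)) v0 V0 u0 U0 (aa n i)) ->
     is_strategy_hat (P t) v0 V0 u0 U0 ahat)) /\
  (forall (b : R -> cpath d T t -> U -> V)
      (bb : forall n : 'I_N, 'I_(l n) -> R -> cpath d T (tn n) -> U -> V),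
    let bhat := paste tau A b bb in
    (is_strategy (P t) u0 U0 v0 V0 b ->
     (forall (n : 'I_N) i, is_strategy (P (tn n)) u0 U0 v0 V0 (bb n i)) ->
     is_strategy (P t) u0 U0 v0 V0 bhat /\
     forall mu, is_control (P t) u0 U0 mu ->
       {ae P t, forall w, forall r, `[tau w, T] r ->
         (forall (n : 'I_N) i (Aw : A n i w) (w' : cpath d T (tau w)),
           path_shift (tau w) (strategy_app bhat mu) w r w' =
           strategy_app (bb n i) (path_shift (tn n) mu w) r (cpath_cast (A_tau n i w Aw) w')) /\
         (A0 w -> forall w' : cpath d T (tau w),
           path_shift (tau w) (strategy_app bhat mu) w r w' = path_shift (tau w) (strategy_app b mu) w r w')}) /\
    (is_strategy_hat (P t) u0 U0 v0 V0 b ->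
     (forall (n : 'I_N) i, is_strategy_hat (P (tn n)) u0 U0 v0 V0 (bb n i)) ->
     is_strategy_hat (P t) u0 U0 v0 V0 bhat)).
Proof.
move=> A0.
have /all_and2[ttn tnT] : forall n, t <= tn n /\ tn n <= T.
  move=> n; have := tn_rat n; rewrite /rational_times/= in_itv/=.
  move=> [[/andP[-> /ltW->]//]|->].
  by move: t_in; rewrite /= in_itv/= => /andP[].
have Pt_wiener : is_wiener (P t) by exact: P_wiener.
have Ptn_wiener n : is_wiener (P (tn n)).
  apply: P_wiener; rewrite /= in_itv/= tnT andbT (le_trans _ (ttn n))//.
  by move: t_in; rewrite /= in_itv/= => /andP[].
have strategyP (X : metricType R) x0 X0 (Y : metricType R) y0 Y0 a aa
    (sa : is_strategy (P t) x0 X0 y0 Y0 a)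
    (saa : forall (n : 'I_N) i, is_strategy (P (tn n)) x0 X0 y0 Y0 (aa n i)) :=
  @paste_strategy R d T t tau N tn ttn tnT tn_inj l A A_meas A_tau A_disj
    P Pt_wiener Ptn_wiener X x0 X0 Y y0 Y0 a aa sa saa.
have hatP (X : metricType R) x0 X0 (Y : metricType R) y0 Y0 a aa
    (sa : is_strategy_hat (P t) x0 X0 y0 Y0 a)
    (saa : forall (n : 'I_N) i, is_strategy_hat (P (tn n)) x0 X0 y0 Y0 (aa n i)) :=
  @paste_strategy_hat R d T t tau N tn ttn tnT tn_inj l A A_meas A_tau A_disj
    P Pt_wiener Ptn_wiener X x0 X0 Y y0 Y0 a aa sa saa.
have shiftP (X Y : Type) (a : R -> cpath d T t -> X -> Y) aa m w r :
    `[tau w, T] r ->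
    (forall (n : 'I_N) i (Aw : A n i w) (w' : cpath d T (tau w)),
      path_shift (tau w) (strategy_app (paste tau A a aa) m) w r w' =
      strategy_app (aa n i) (path_shift (tn n) m w) r
        (cpath_cast (A_tau n i w Aw) w')) /\
    (A0 w -> forall w' : cpath d T (tau w),
      path_shift (tau w) (strategy_app (paste tau A a aa) m) w r w' =
      path_shift (tau w) (strategy_app a m) w r w').
  move=> rT; split=> [n i Aw w'|A0w w'].
    apply: paste_shift_in => //.
    by move: rT; rewrite /= in_itv/= => /andP[].
  apply: paste_shift_out => // n i Aw; apply: A0w.
  by exists n => //; exists i.
split=> a aa ahat; (split; last exact: hatP).
- move=> sa saa; split; first exact: strategyP.
  by move=> nu _; apply: aeW => w r; exact: shiftP.
- move=> sa saa; split; first exact: strategyP.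
  by move=> nu _; apply: aeW => w r; exact: shiftP.
Qed.
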